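(* For every integer $p > 1$, the following problem can be solved in polynomial time: given a chordal graph $G$, find a minimum set $V_-\subseteq V(G)$ such that $G - V_-$ contains no clique on $p$ vertices.
   Context: All graphs are finite, simple and undirected. A graph is chordal if every cycle of length greater than three has a chord. $K_p$ denotes the complete graph on $p$ vertices, and a graph is $K_p$-free if it has no induced (equivalently, no) subgraph isomorphic to $K_p$. *)

(* Defs.v *)
From HB Require Import structures.
From mathcomp Require Import all_boot.

Set Implicit Arguments.
Unset Strict Implicit.
Unset Printing Implicit Defensive.

Record sgraph := SGraph {
  vertex :> finType;
  adj : rel vertex;
  adj_sym : symmetric adj;
  adj_irr : irreflexive adj
}.

(* [c] lists the vertices of a cycle in order; a chord is an edge between two
   vertices that are not consecutive on [c]. *)
Definition chordal (G : sgraph) : Prop :=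
  forall c : seq G, ucycle (@adj G) c -> 3 < size c ->
  exists x y : G, [/\ x \in c, y \in c, adj x y, next c x != y & next c y != x].

Definition clique (G : sgraph) (K : {set G}) : Prop :=
  {in K &, forall x y, x != y -> adj x y}.

Definition has_clique (G : sgraph) (p : nat) : Prop :=
  exists K : {set G}, clique K /\ #|K| = p.

Definition del_adj (G : sgraph) (V : {set G}) : rel {x : G | x \notin V} :=
  fun x y => adj (val x) (val y).

Lemma del_adj_sym (G : sgraph) (V : {set G}) : symmetric (@del_adj G V).
Proof. by move=> x y; apply: adj_sym. Qed.

Lemma del_adj_irr (G : sgraph) (V : {set G}) : irreflexive (@del_adj G V).
Proof. by move=> x; apply: adj_irr. Qed.

Definition del_vertices (G : sgraph) (V : {set G}) : sgraph :=
  SGraph (@del_adj_sym G V) (@del_adj_irr G V).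

Definition clique_deletion_set (p : nat) (G : sgraph) (V : {set G}) : Prop :=
  ~ has_clique (del_vertices V) p.

Definition min_clique_deletion_set (p : nat) (G : sgraph) (V : {set G}) : Prop :=
  clique_deletion_set p V /\
  forall W : {set G}, clique_deletion_set p W -> #|V| <= #|W|.

(* Adjacency matrix in row-major order, and characteristic vector. *)
Definition encode_graph (G : sgraph) : seq bool :=
  [seq adj x y | x <- enum G, y <- enum G].

Definition encode_vset (G : sgraph) (V : {set G}) : seq bool :=
  [seq x \in V | x <- enum G].

(* The random access machine of Cook and Reckhow (Time bounded random access
   machines, 1973), over nat with truncated subtraction. One step costs one time
   unit; since there is no multiplication, t steps only produce numbers of O(t)
   bits, so polynomial time in this sense is polynomial time on Turing
   machines. *)
Inductive instr :=
  | IConst of nat & nat (* X_i := c *)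
  | IAdd of nat & nat & nat (* X_i := X_j + X_k *)
  | ISub of nat & nat & nat (* X_i := X_j - X_k *)
  | IGet of nat & nat (* X_i := X_(X_j) *)
  | IPut of nat & nat (* X_(X_i) := X_j *)
  | IJump of nat & nat (* go to instruction m if X_j > 0 *)
  | IRead of nat (* X_i := next input bit, 2 if none is left *)
  | IPrint of nat. (* output the bit X_i > 0 *)

Definition program := seq instr.

Record config := Config {
  pc : nat;
  reg : nat -> nat;
  input : seq bool;
  output : seq bool
}.

Definition initial (w : seq bool) : config := Config 0 (fun=> 0) w [::].

Definition set_reg (r : nat -> nat) (i v : nat) : nat -> nat :=
  fun j => if j == i then v else r j.

Definition exec (c : config) (a : instr) : config :=
  let: Config l r x y := c in
  match a with
  | IConst i n => Config l.+1 (set_reg r i n) x y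
  | IAdd i j k => Config l.+1 (set_reg r i (r j + r k)) x y
  | ISub i j k => Config l.+1 (set_reg r i (r j - r k)) x y
  | IGet i j => Config l.+1 (set_reg r i (r (r j))) x y
  | IPut i j => Config l.+1 (set_reg r (r i) (r j)) x y
  | IJump m j => Config (if 0 < r j then m else l.+1) r x y
  | IRead i =>
      let b := if x is b :: _ then nat_of_bool b else 2 in
      Config l.+1 (set_reg r i b) (behead x) y
  | IPrint i => Config l.+1 r x (rcons y (0 < r i))
  end.

(* The machine halts when the program counter leaves the program. *)
Definition step (P : program) (c : config) : config :=
  if onth P (pc c) is Some a then exec c a else c.

Definition computes_in (P : program) (w : seq bool) (t : nat) (z : seq bool) :
    Prop :=
  let c := iter t (step P) (initial w) in size P <= pc c /\ output c = z.

(* Search problem: given an instance [i] satisfying [promise], return the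
   encoding of some [s] with [sol i s]. *)
Definition poly_time_solvable (I : Type) (S : I -> Type)
    (encI : I -> seq bool) (encS : forall i, S i -> seq bool)
    (promise : I -> Prop) (sol : forall i, S i -> Prop) : Prop :=
  exists (P : program) (c k : nat), forall i : I, promise i ->
  exists (t : nat) (s : S i),
    [/\ t <= c * size (encI i) ^ k + c,
        computes_in P (encI i) t (encS i s) & sol i s].

(* Main.v *)
Require Import Defs.
From HB Require Import structures.
From mathcomp Require Import all_boot zify.

Set Implicit Arguments.
Unset Strict Implicit.
Unset Printing Implicit Defensive.

(* In a chordal graph every nonempty set of vertices has a simplicial vertex, so
   that with [t = p - 1] an induced subgraph has no clique on [p] vertices iff it
   is [t]-colourable. A largest [t]-colourable induced subgraph is found by
   dynamic programming along a simplicial elimination: the eliminated vertices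
   split into blocks, each attached to the remaining graph by a clique, and a
   colouring of the rest restricts the colouring of a block only through the
   vertex, if any, of each colour in that clique, that is, through one of
   polynomially many [t]-tuples. The deletion set itself is found greedily: a
   vertex is deleted whenever the optimum does not drop.

   The algorithm is written in a small language whose loops all run over
   [0, ..., N - 1], with [N] the input length plus four, so that a syntactic
   bound on the running time of the compiled code is polynomial. *)

(** * Simplicial vertices of chordal graphs *)

(** A tuple entry saying that a colour is absent from the clique is an isolated vertex, so the
    recurrence needs no case distinction for it. To have such a vertex the graph is padded: every
    number below [N] counts as a vertex, and since [N = n * n + 4] for a graph with [n] vertices,
    the numbers from [n] to [N - 1] are isolated vertices. The constant 4 also puts the tags 0, ...,
    3 of the four tables below [N], so that a table key is a list of digits in base [N]. Written
    behind a leading digit 1, a nonempty key becomes an address of at least [N], beyond the [n * n]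
    cells that hold the adjacency matrix. The machine does not multiply, so products, in particular
    those in addresses, are written as sums, whose nesting depth depends on [t] only. Minimality is
    proved for the padded graph, as maximality of the set of kept vertices, and is carried back to
    the given graph by counting complements. *)

Definition simplicial (T : finType) (e : rel T) (A : {set T}) (v : T) : Prop :=
  {in A &, forall a b, e v a -> e v b -> a != b -> e a b}.

Lemma next_mid (T : eqType) (s1 s2 : seq T) a b :
  uniq (s1 ++ a :: b :: s2) -> next (s1 ++ a :: b :: s2) a = b.
Proof.
move=> U; rewrite next_nth mem_cat mem_head orbT.
have I : index a (s1 ++ a :: b :: s2) = size s1.
  move: U; rewrite cat_uniq /= negb_or => /and3P[_ /andP[as1 _] _].
  by rewrite index_cat (negPf as1) /= eqxx addn0.
rewrite I; case: s1 {U I} => [|z s1] //=.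
by rewrite nth_cat ltnNge leqnSn /= subSnn.
Qed.

Lemma next_last (T : eqType) (s : seq T) a b :
  uniq (a :: rcons s b) -> next (a :: rcons s b) b = a.
Proof.
rewrite -rcons_cons rcons_uniq => /andP[bs _].
have I : index b (rcons (a :: s) b) = (size s).+1.
  by rewrite -cats1 index_cat (negPf bs) /= eqxx addn0.
by rewrite next_nth mem_rcons mem_head I /= nth_default // size_rcons.
Qed.

Lemma path_shortcut (T : eqType) (e : rel T) x q s1 a s3 b s4 :
  x :: q = s1 ++ a :: s3 ++ b :: s4 -> s3 != [::] -> e a b -> path e x q ->
  exists q', [/\ size q' < size q, path e x q', last x q' = last x q &
                 {subset q' <= q}].
Proof.
case: s1 => [|z s1] /= [xE ->] s3n eab; first rewrite -{}xE in eab.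
  rewrite cat_path /= => /and3P[_ _ P]; exists (b :: s4); split=> //=.
  - by rewrite size_cat /=; case: (s3) s3n => //= *; lia.
  - by rewrite eab.
  - by rewrite last_cat.
  - by move=> z zs; rewrite mem_cat zs orbT.
rewrite cat_path /= cat_path /= => /and5P[P1 P2 _ _ P].
exists (s1 ++ a :: b :: s4); split=> //=.
- by rewrite !size_cat /= size_cat /=; case: (s3) s3n => //= *; lia.
- by rewrite cat_path /= P1 P2 eab.
- by rewrite !last_cat /= last_cat.
- move=> w; rewrite !mem_cat !inE !mem_cat !inE => /orP[->//|/or3P[->|->|->]];
  by rewrite ?orbT.
Qed.

(** The path and [u] close up to a cycle on which [u] sees only [x] and [y], so a chord joins two
    vertices of the path and shortens it. Induction on the length ends with the edge between [x] and
    [y]. *)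
Lemma chordal_shortcut (G : sgraph) (u x y : G) (C : pred G) (q : seq G) :
  chordal G -> adj u x -> adj u y -> x != y ->
  (forall z, C z -> z != u /\ ~~ adj u z) ->
  path (@adj G) x q -> last x q = y ->
  (forall z, z \in q -> (z == y) || C z) -> adj x y.
Proof.
move=> chG ux uy xy HC; move: {2}(size q) (leqnn (size q)) => n.
elim: n q => [|n IH] q; first by case: q => //= _ _ E; rewrite E eqxx in xy.
move=> szq Pq Lq Hq.
(* Repetitions are cut out first, since chordality speaks only of cycles without repeated
   vertices. *)
have [q' [Pq' Uq' Lq' Hq' szq']] : exists q', [/\ path (@adj G) x q',
    uniq (x :: q'), last x q' = y, (forall z, z \in q' -> (z == y) || C z) &
    size q' <= n.+1].
  case: (shortenP Pq) Lq => q' Pq' Uq' sub Lq'; exists q'; split=> //.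
    by move=> z zq; apply/Hq/sub.
  by apply: leq_trans szq; apply: uniq_leq_size sub; case/andP: Uq'.
case/lastP: q' => [|q' y'] in Pq' Uq' Lq' Hq' szq' *.
  by rewrite /= in Lq'; rewrite Lq' eqxx in xy.
rewrite last_rcons in Lq'; rewrite {y'}Lq' in Pq' Uq' Hq' szq'.
case: (posnP (size q')) => [/size0nil q0|q0]; first by rewrite q0 /= andbT in Pq'.
have Uc : uniq (u :: x :: rcons q' y).
  rewrite cons_uniq Uq' andbT in_cons negb_or; apply/andP; split.
    by apply: contraTneq ux => <-; rewrite adj_irr.
  apply/negP => /Hq' /orP[/eqP E|/HC [/eqP //]].
  by rewrite E adj_irr in uy.
have uN z : z \in x :: rcons q' y -> adj u z -> z = x \/ z = y.
  rewrite in_cons => /orP[/eqP->|/Hq' /orP[/eqP->|/HC [_ /negP]//]]; by [left|right].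
have u_no z : z \in x :: rcons q' y -> adj u z ->
    next (u :: x :: rcons q' y) u != z -> next (u :: x :: rcons q' y) z != u -> False.
  move=> zq /(uN _ zq) [->|->].
    by rewrite (@next_mid _ [::] (rcons q' y) u x Uc) eqxx.
  by rewrite -rcons_cons next_last ?eqxx.
(* The stretch [s2] skipped by a chord is nonempty, because the ends of a chord are not consecutive
   on the cycle. *)
have short a b s1 s2 s3 : x :: rcons q' y = s1 ++ a :: s2 ++ b :: s3 ->
    next (u :: x :: rcons q' y) a != b -> adj a b -> adj x y.
  move=> E nab eab.
  have s2n : s2 != [::].
    apply: contra nab => /eqP s20; rewrite s20 /= in E; rewrite E.
    by rewrite (@next_mid _ (u :: s1)) //= -E.
  have [q2 [sz2 P2 L2 S2]] := path_shortcut E s2n eab Pq'.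
  apply: (IH q2 _ P2); rewrite ?L2 ?last_rcons //.
    by rewrite -ltnS (leq_trans sz2).
  by move=> z /S2; apply: Hq'.
have [||a [b []]] := chG (u :: x :: rcons q' y) _ _.
- by rewrite /ucycle Uc andbT /= ux rcons_path Pq' last_rcons adj_sym uy.
- by rewrite /= size_rcons; lia.
rewrite !(in_cons u) => /orP[/eqP->|aq] /orP[/eqP->|bq].
- by rewrite adj_irr.
- by move=> uz n1 n2; case: (u_no _ bq uz n1 n2).
- by rewrite adj_sym => uz n1 n2; case: (u_no _ aq uz n2 n1).
move=> eab n1 n2.
case/splitPr Eq : {1}(x :: rcons q' y) / aq => [s1 s2].
move: bq; rewrite Eq mem_cat in_cons => /or3P[bs|/eqP ba|bs].
- case/splitPr Es : {1}s1 / bs => [s3 s4].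
  apply: (short b a s3 s4 s2) => //; last by rewrite adj_sym.
  by rewrite Eq Es -catA.
- by rewrite ba adj_irr in eab.
- case/splitPr Es : {1}s2 / bs => [s3 s4].
  by apply: (short a b s1 s3 s4) => //; rewrite Eq Es.
Qed.

(** If no vertex of [A] misses another one, then [A] is a clique and all its vertices are
    simplicial. *)
Lemma simplicial_of_far (T : finType) (e : rel T) (A : {set T}) z :
  z \in A ->
  (forall u, u \in A -> (exists2 w, w \in A & (w != u) && ~~ e u w) ->
     exists2 v, v \in A & [/\ v != u, ~~ e u v & simplicial e A v]) ->
  exists2 v, v \in A & simplicial e A v.
Proof.
move=> zA far.
case: (pickP [pred ab : T * T | [&& ab.1 \in A, ab.2 \in A, ab.2 != ab.1 &
                                   ~~ e ab.1 ab.2]]).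
  move=> [a b] /= /and4P[aA bA ba ab].
  have [|v vA [_ _ sv]] := far a aA; last by exists v.
  by exists b => //; rewrite ba.
move=> none; exists z => // a b aA bA _ _ ab.
by have := none (a, b); rewrite /= aA bA eq_sym ab /= => /negbFE.
Qed.

(** A form of Dirac's theorem on simplicial vertices that is strong enough for induction: the
    simplicial vertex can be found away from any prescribed vertex that misses some vertex of [A].
    The induction passes to a part of [A] cut off from [u] by a clique. *)
Lemma simplicial_far (G : sgraph) : chordal G -> forall (A : {set G}) u,
  u \in A -> (exists2 w, w \in A & (w != u) && ~~ adj u w) ->
  exists2 v, v \in A & [/\ v != u, ~~ adj u v & simplicial (@adj G) A v].
Proof.
move=> chG A; move: {2}#|A| (leqnn #|A|) => n; elim: n A => [|n IH] A.
  by rewrite leqn0 cards_eq0 => /eqP-> u; rewrite inE.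
move=> szA u uA [w wA /andP[wu uw]].
have ex (B : {set G}) z : z \in B -> #|B| <= n ->
    exists2 v, v \in B & simplicial (@adj G) B v.
  by move=> zB szB; apply: simplicial_of_far zB (IH B szB).
pose F := [set z in A | (z != u) && ~~ adj u z].
pose r : rel G := fun z z' => [&& adj z z', z \in F & z' \in F].
have r_sym : connect_sym r.
  by apply: sym_connect_sym => z z'; rewrite /r adj_sym [(z \in F) && _]andbC.
have wF : w \in F by rewrite inE wA wu.
(* [C] is the component of [w] among the vertices of [A] that [u] misses; [B] below is its boundary
   in [A], contained in the neighbourhood of [u]. *)
pose C := [set z | connect r w z].
have rF z z' : connect r z z' -> z \in F -> z' \in F.
  case/connectP=> p; elim: p z => [|y p IHp] z /=; first by move=> _ ->.
  by move=> /andP[/and3P[_ _ yF] Pp] E _; apply: (IHp y).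
have CF z : z \in C -> z \in F by rewrite inE => /rF; apply.
have Cstep z z' : z \in C -> z' \in F -> adj z z' -> z' \in C.
  move=> zC z'F zz'; move: (zC); rewrite !inE => /connect_trans; apply.
  by apply: connect1; rewrite /r zz' z'F CF.
pose B := [set b in A | (b \notin C) && [exists c in C, adj c b]].
have BP b : b \in B -> [/\ b \in A, b \notin C & exists2 c, c \in C & adj c b].
  rewrite inE => /and3P[bA bC /existsP[c /andP[cC cb]]]; split=> //.
  by exists c.
have Bu b : b \in B -> adj u b.
  case/BP=> bA bC [c cC cb]; apply: contraR bC => ub; apply: (Cstep c b cC _ cb).
  rewrite inE bA ub andbT; apply: contraTneq cb => ->.
  by move/CF: cC; rewrite inE adj_sym => /and3P[].
(* The boundary is a clique: two of its vertices are neighbours of [u] joined by a path through [C],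
   which avoids the neighbours of [u]. *)
have Bcl : {in B &, forall x y, x != y -> adj x y}.
  move=> x y xB yB xy; have [xA xC [c cC cx]] := BP x xB.
  have [yA yC [c' c'C c'y]] := BP y yB.
  have : connect r c c'.
    by move: cC c'C; rewrite !inE r_sym => c1 c2; apply: connect_trans c1 c2.
  case/connectP=> p Pp c'E.
  have pC z : z \in c :: p -> z \in C.
    move=> zp; move: (cC); rewrite !inE => /connect_trans; apply.
    exact: path_connect Pp _ zp.
  apply: (@chordal_shortcut G u x y [in C] (rcons (c :: p) y)) => //.
  - exact: Bu.
  - exact: Bu.
  - by move=> z /CF; rewrite inE => /and3P[].
  - rewrite rcons_path /= -c'E c'y adj_sym cx andbT /=.
    by apply: sub_path Pp => a b /and3P[].
  - by rewrite last_rcons.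
  - by move=> z; rewrite mem_rcons in_cons => /orP[->//|/pC zC]; rewrite zC orbT.
have CA z : z \in C -> z \in A by move/CF; rewrite inE => /andP[].
have uC : u \notin C by apply/negP => /CF; rewrite inE eqxx andbF.
have nbr z a : z \in C -> a \in A -> adj z a -> a \in C :|: B.
  move=> zC aA za; rewrite in_setU; case: (boolP (a \in C)) => //= aC.
  by rewrite inE aA aC; apply/existsP; exists z; rewrite zC.
have szCB : #|C :|: B| <= n.
  rewrite -ltnS; apply: leq_trans szA; apply: proper_card; apply/properP; split.
    by apply/subsetP => z; rewrite in_setU => /orP[/CA//|/BP[]].
  exists u => //; rewrite in_setU (negPf uC) /=.
  by apply/negP => /Bu; rewrite adj_irr.
(* A vertex of [C] has all its neighbours from [A] in [C :|: B], so being simplicial there is the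
   same as being simplicial in [A]. *)
suff [v vC sv] : exists2 v, v \in C & simplicial (@adj G) (C :|: B) v.
  exists v; first exact: CA.
  split; [by move/CF: vC; rewrite inE => /and3P[]..|].
  by move=> a b aA bA va vb; apply: sv; rewrite // (nbr v).
(* If some [b] in [B] misses a vertex of [C], induction away from [b] gives a simplicial vertex that
   misses [b]; it cannot lie in the clique [B]. *)
case: (pickP [pred bz : G * G | [&& bz.1 \in B, bz.2 \in C & ~~ adj bz.1 bz.2]]).
  move=> [b z] /= /and3P[bB zC bz].
  have [||v vCB [vb bv sv]] := IH _ szCB b.
  - by rewrite in_setU bB orbT.
  - exists z; first by rewrite in_setU zC.
    by rewrite bz andbT; apply: contraTneq zC => ->; case/BP: bB.
  exists v => //; move: vCB; rewrite in_setU => /orP[//|vB].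
  by rewrite (Bcl b v) // eq_sym in bv.
(* Now [B] is completely joined to [C], so a vertex simplicial in [C] remains simplicial in
   [C :|: B]. *)
move=> all_adj.
have wC : w \in C by rewrite inE connect0.
have [|v vC sv] := ex C w wC.
  by apply: leq_trans szCB; rewrite subset_leq_card // subsetUl.
have BC b z : b \in B -> z \in C -> adj b z.
  by move=> bB zC; have := all_adj (b, z); rewrite /= bB zC /= => /negbFE.
exists v => // a b; rewrite !in_setU => /orP[aC|aB] /orP[bC|bB] va vb ab.
- exact: sv.
- by rewrite adj_sym BC.
- by rewrite BC.
- exact: Bcl.
Qed.

(** Stated for a bare relation, because it is needed both for the given graph and for its padded
    copy on ['I_N]. *)
Definition simplicial_elimination (T : finType) (e : rel T) : Prop :=
  forall (A : {set T}) z, z \in A -> exists2 v, v \in A & simplicial e A v.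

Lemma chordal_elimination (G : sgraph) :
  chordal G -> simplicial_elimination (@adj G).
Proof.
by move=> chG A z zA; apply: simplicial_of_far zA (simplicial_far chG (A := A)).
Qed.

(** * Colourings with a boundary condition *)

(** Chordal graphs are perfect: a simplicial vertex forms a clique with its neighbours, so at most
    [t - 1] colours are forbidden to it when it is put back last. *)
Lemma greedy_colouring (T : finType) (e : rel T) (t : nat) (S : {set T}) :
  symmetric e -> irreflexive e -> simplicial_elimination e ->
  (forall K : {set T}, K \subset S -> {in K &, forall x y, x != y -> e x y} ->
     #|K| <= t) ->
  exists c : T -> nat, {in S, forall u, c u < t} /\
    {in S &, forall u u', c u = c u' -> ~~ e u u'}.
Proof.
move=> e_sym e_irr elim_e; move: {2}#|S| (leqnn #|S|) => n.
elim: n S => [|n IH] S szS free.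
  move: szS; rewrite leqn0 cards_eq0 => /eqP ->.
  by exists (fun=> 0); split=> u; rewrite inE.
have [->|[z zS]] := set_0Vmem S.
  by exists (fun=> 0); split=> u; rewrite inE.
have [v vS sv] := elim_e S z zS.
have [||c [c_lt c_ok]] := IH (S :\ v).
- by move: szS; rewrite (cardsD1 v) vS.
- by move=> K KS; apply: free; apply: subset_trans KS (subD1set _ _).
pose M := [set a in S | e v a].
have vM : v \notin M by rewrite inE e_irr andbF.
have ltM : #|M| < t.
  have := free (v |: M); rewrite cardsU1 vM add1n; apply.
    apply/subsetP => a; rewrite !inE => /orP[/eqP->//|/andP[]//].
  move=> a b; rewrite !inE => /orP[/eqP->|/andP[aS va]] /orP[/eqP->|/andP[bS vb]].
  - by rewrite eqxx.
  - by [].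
  - by rewrite e_sym.
  - exact: sv.
have [j jt jM] : exists2 j, j < t & j \notin map c (enum M).
  case: (boolP (all [in map c (enum M)] (iota 0 t))) => [/allP sub|].
    have := uniq_leq_size (iota_uniq 0 t) sub.
    by rewrite size_iota size_map -cardE leqNgt ltM.
  by case/allPn=> j; rewrite mem_iota => jt jM; exists j.
have vj u : u \in S -> c u = j -> ~~ e v u.
  move=> uS cu; apply: contra jM => vu; rewrite -cu map_f //.
  by rewrite mem_enum inE uS.
exists (fun u => if u == v then j else c u); split=> [u uS|u u' uS u'S].
  by case: eqP => // /eqP uv; apply: c_lt; rewrite !inE uv.
case: eqP => [->|/eqP uv]; case: eqP => [->|/eqP u'v].
- by rewrite e_irr.
- by move=> ju'; apply: vj.
- by move=> uj; rewrite e_sym; apply: vj.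
- by apply: c_ok; rewrite !inE ?uv ?u'v.
Qed.

Section BoundedColouring.

Variables (T : finType) (e : rel T) (t : nat) (x0 : T).
Hypotheses (e_sym : symmetric e) (e_irr : irreflexive e).
Hypothesis (x0_isolated : forall u, ~~ e x0 u).

(* A partial [t]-colouring is a map [c : T -> nat], the vertices with [t <= c u]
   being uncoloured; [xs] lists, for each colour, one outside vertex that
   already has it. *)
Definition colours (D U : {set T}) (xs : seq T) (c : T -> nat) : Prop :=
  {in U &, forall u u', c u < t -> c u = c u' -> ~~ e u u'} /\
  {in U, forall u, c u < t -> u \notin D /\ ~~ e (nth x0 xs (c u)) u}.

Definition coloured (U : {set T}) (c : T -> nat) := [set u in U | c u < t].

Definition max_coloured (D U : {set T}) (xs : seq T) (m : nat) : Prop :=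
  (exists2 c, colours D U xs c & #|coloured U c| = m) /\
  (forall c, colours D U xs c -> #|coloured U c| <= m).

(** Blocks with no common vertex and no edge between them are coloured independently. The optimal
    colourings are glued along [own], which sends a vertex to its block. *)
Lemma max_coloured_bigcup (D R : {set T}) (sub : T -> {set T}) xs m :
  {in R &, forall w w' u, u \in sub w -> u \in sub w' -> w = w'} ->
  {in R &, forall w w' u u', u \in sub w -> u' \in sub w' -> e u u' -> w = w'} ->
  {in R, forall w, max_coloured D (sub w) xs (m w)} ->
  max_coloured D (\bigcup_(w in R) sub w) xs (\sum_(w in R) m w).
Proof.
move=> disj noedge best.
pose own u := odflt x0 [pick w in R | u \in sub w].
have ownE w u : w \in R -> u \in sub w -> own u = w.
  move=> wR uw; rewrite /own; case: pickP => [w' /andP[w'R uw']|/(_ w)] /=.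
    exact: (disj w' w w'R wR u).
  by rewrite wR uw.
have card c : #|coloured (\bigcup_(w in R) sub w) c| =
    \sum_(w in R) #|coloured (sub w) c|.
  rewrite -sum1_card (partition_big own [in R]) /=; last first.
    by move=> u; rewrite inE => /andP[/bigcupP[w wR /(ownE w u wR) ->]].
  apply: eq_bigr => w wR; rewrite -sum1_card; apply: eq_bigl => u.
  rewrite !inE; apply/andP/andP => [[/andP[/bigcupP[w' w'R uw'] cu] /eqP]|[uw cu]].
    by rewrite (ownE w' u) // => <-.
  by rewrite cu (ownE w u) // eqxx andbT; split=> //; apply/bigcupP; exists w.
split; last first.
  move=> c [c1 c2]; rewrite card; apply: leq_sum => w wR.
  apply: (best w wR).2; split=> [u u' uw u'w|u uw]; [apply: c1|apply: c2];
    by apply/bigcupP; exists w.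
have [w|f fP] := @fin_all_exists T (fun=> T -> nat) (fun w c => w \in R ->
    colours D (sub w) xs c /\ #|coloured (sub w) c| = m w).
  case: (boolP (w \in R)) => [/best[[c c1 c2] _]|_]; last by exists (fun=> 0).
  by exists c.
exists (fun u => f (own u) u).
  split=> [u u' /bigcupP[w wR uw] /bigcupP[w' w'R u'w']|u /bigcupP[w wR uw]].
    rewrite (ownE w u) // (ownE w' u') // => lt eqc.
    apply/negP => uu'; have ww' := noedge w w' wR w'R u u' uw u'w' uu'.
    rewrite -ww' in eqc u'w'.
    by have [[c1 _] _] := fP w wR; move: uu'; apply/negP/c1.
  by rewrite (ownE w u) // => lt; have [[_ c2] _] := fP w wR; apply: c2.
rewrite card; apply: eq_bigr => w wR; have [_ <-] := fP w wR.
apply: eq_card => u; rewrite !inE.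
by case: (boolP (u \in sub w)) => // uw; rewrite (ownE w u).
Qed.

(** Either [v] stays uncoloured, or it gets a colour [j] and takes slot [j] of the boundary tuple.
    The outside vertex previously in that slot may be forgotten: if it does not conflict with [v],
    it has no neighbour in [U]. *)
Lemma max_coloured_add (D U : {set T}) v xs m0 m M :
  v \notin U -> size xs = t -> max_coloured D U xs m0 ->
  (forall j, j < t -> max_coloured D U (set_nth x0 xs j v) (m j)) ->
  (forall j, j < t -> ~~ e (nth x0 xs j) v ->
     {in U, forall u, ~~ e (nth x0 xs j) u}) ->
  m0 <= M ->
  (forall j, j < t -> v \notin D -> ~~ e (nth x0 xs j) v -> (m j).+1 <= M) ->
  M = m0 \/ (exists2 j, j < t &
    [/\ v \notin D, ~~ e (nth x0 xs j) v & M = (m j).+1]) ->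
  max_coloured D (v |: U) xs M.
Proof.
move=> vU szx best0 bestj far le0 lej attained.
have cardv c : #|coloured (v |: U) c| = (c v < t) + #|coloured U c|.
  rewrite (cardsD1 v) !inE eqxx /=; congr addn; apply: eq_card => u.
  by rewrite !inE; case: eqP => // ->; rewrite (negPf vU).
have uv u : u \in U -> (u == v) = false by move=> uU; apply: contraNF vU => /eqP <-.
split; last first.
  move=> c [c1 c2]; rewrite cardv.
  have c1' : {in U &, forall u u', c u < t -> c u = c u' -> ~~ e u u'}.
    by move=> u u' uU u'U; apply: c1; rewrite !inE ?uU ?u'U orbT.
  case: ltnP => cv; last first.
    apply: leq_trans le0; apply: best0.2; split=> // u uU.
    by apply: c2; rewrite !inE uU orbT.
  have [vD xv] := c2 v (setU11 _ _) cv.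
  apply: leq_trans (lej _ cv vD xv); rewrite add1n ltnS.
  apply: (bestj _ cv).2; split=> // u uU ut.
  have [|uD xu] := c2 u _ ut; first by rewrite !inE uU orbT.
  split=> //; rewrite nth_set_nth /=; case: eqP => // cuv.
  by apply: c1; rewrite ?cuv // !inE ?eqxx ?uU ?orbT.
case: attained => [->|[j jt [vD xv ->]]].
  have [[c [c1 c2] sz] _] := best0.
  (* The value [t] marks [v] as uncoloured. *)
  exists (fun u => if u == v then t else c u); last first.
    rewrite cardv eqxx ltnn -sz; apply: eq_card => u; rewrite !inE.
    by case: (boolP (u \in U)) => //= uU; rewrite uv.
  split=> [u u' /setU1P[->|uU] /setU1P[->|u'U]|u /setU1P[->|uU]];
    rewrite ?eqxx ?ltnn // ?uv //.
  - by move=> lt E; rewrite E ltnn in lt.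
  - exact: c1.
  - exact: c2.
have [[c [c1 c2] sz] _] := bestj j jt.
exists (fun u => if u == v then j else c u); last first.
  rewrite cardv eqxx jt -sz add1n; congr _.+1; apply: eq_card => u; rewrite !inE.
  by case: (boolP (u \in U)) => //= uU; rewrite uv.
have vu u : u \in U -> c u = j -> ~~ e v u.
  move=> uU cu; have [|_] := c2 u uU; first by rewrite cu.
  by rewrite cu nth_set_nth /= eqxx.
split=> [u u' /setU1P[->|uU] /setU1P[->|u'U]|u /setU1P[->|uU]];
  rewrite ?eqxx ?uv //.
- by rewrite e_irr.
- by move=> _ E; apply: vu.
- by move=> _ E; rewrite e_sym; apply: vu.
- exact: c1.
- move=> ut; have [uD xu] := c2 u uU ut; split=> //.
  by move: xu; rewrite nth_set_nth /=; case: eqP => // -> _; apply: far.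
Qed.
(* Eliminating the vertices one by one, [A] is the set of the remaining ones.
   The eliminated part splits into blocks [sub w], one for each root [w] in [R],
   such that a block meets the outside only in the clique of the neighbours of
   its root in [A]; [g w xs] is the optimum on the block of [w]. *)
Record elim_state (D A R : {set T}) (sub : T -> {set T})
    (g : T -> seq T -> nat) : Prop := ElimState {
  elim_root : {in R, forall w, w \notin A};
  elim_cover : \bigcup_(w in R) sub w = ~: A;
  elim_disjoint : {in R &, forall w w' u, u \in sub w -> u \in sub w' -> w = w'};
  elim_clique : {in R, forall w, simplicial e A w};
  elim_nbr : {in R, forall w u u', u \in sub w -> e u u' ->
    u' \in sub w \/ u' \in A /\ e w u'};
  elim_val : {in R, forall w xs, size xs = t ->
    all (fun x => (x \in A) || (x == x0)) xs ->
    max_coloured D (sub w) xs (g w xs)}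
}.

Lemma elim_state0 D sub g : elim_state D setT set0 sub g.
Proof.
split; try by [move=> w; rewrite inE | move=> w w'; rewrite inE].
by rewrite big_set0 setCT.
Qed.

Lemma elim_sub D A R sub g w u :
  elim_state D A R sub g -> w \in R -> u \in sub w -> u \notin A.
Proof.
move=> H wR uw; rewrite -in_setC -(elim_cover H).
by apply/bigcupP; exists w.
Qed.

Lemma elim_union D A R sub g (R' : {set T}) xs :
  elim_state D A R sub g -> R' \subset R -> size xs = t ->
  all (fun x => (x \in A) || (x == x0)) xs ->
  max_coloured D (\bigcup_(w in R') sub w) xs (\sum_(w in R') g w xs).
Proof.
move=> H /subsetP R'R szx xsA; apply: max_coloured_bigcup.
- by move=> w w' /R'R wR /R'R w'R; apply: (elim_disjoint H).
- move=> w w' /R'R wR /R'R w'R u u' uw u'w' uu'.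
  case: (elim_nbr H wR uw uu') => [u'w|[u'A _]].
    exact: (elim_disjoint H wR w'R u'w).
  by have := elim_sub H w'R u'w'; rewrite u'A.
- by move=> w /R'R wR; apply: (elim_val H).
Qed.

Lemma elim_final D R sub g : elim_state D set0 R sub g ->
  max_coloured D setT (nseq t x0) (\sum_(w in R) g w (nseq t x0)).
Proof.
move=> H; have := elim_union H (subxx R) (size_nseq t x0).
rewrite (elim_cover H) setC0; apply.
by rewrite all_nseq inE eqxx !orbT.
Qed.

(** The recurrence of the dynamic programme: [s] is the optimum on the blocks merged under [v], the
    first term leaves [v] uncoloured, and the term of [j] gives it colour [j]. A forbidden colour
    contributes 0. *)
Definition dp_val (D : {set T}) (v : T) (s : seq T -> nat) (xs : seq T) : nat :=
  maxn (s xs) (\max_(j < t) if (v \notin D) && ~~ e (nth x0 xs j) v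
                            then (s (set_nth x0 xs j v)).+1 else 0).

(** The blocks whose root is adjacent to [v] merge with [v] into one block, and the others stay. The
    new block is attached by a clique: its outside neighbours were neighbours of an old root, as was
    [v], hence they are neighbours of [v]. *)
Lemma elim_step D A R sub g v g' :
  elim_state D A R sub g -> v \in A -> simplicial e A v ->
  {in R, forall w xs, size xs = t -> g' w xs = g w xs} ->
  (forall xs, size xs = t -> g' v xs =
     dp_val D v (fun xs => \sum_(w in [set w in R | e w v]) g w xs) xs) ->
  exists sub', elim_state D (A :\ v) (v |: [set w in R | ~~ e w v]) sub' g'.
Proof.
move=> H vA sv g'R g'v.
pose U := \bigcup_(w in [set w in R | e w v]) sub w.
have vR : v \notin R by apply/negP => /(elim_root H); rewrite vA.
have Rv w : w \in R -> (w == v) = false by move=> wR; apply: contraNF vR => /eqP <-.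
have vsub w : w \in R -> v \notin sub w.
  by move=> wR; apply/negP => /(elim_sub H wR); rewrite vA.
have UP u : reflect (exists w, [/\ w \in R, e w v & u \in sub w]) (u \in U).
  apply: (iffP bigcupP) => [[w]|[w [wR wv uw]]]; last by exists w => //; rewrite inE wR.
  by rewrite inE => /andP[wR wv] uw; exists w.
have UA u : u \in U -> u \notin A by case/UP=> w [wR _ uw]; apply: elim_sub H wR uw.
have vU : v \notin U by apply/negP => /UA; rewrite vA.
pose sub' w := if w == v then v |: U else sub w.
have sub'v : sub' v = v |: U by rewrite /sub' eqxx.
have sub'R w : w \in R -> sub' w = sub w by move=> wR; rewrite /sub' Rv.
exists sub'; split.
- move=> w; rewrite !inE => /orP[/eqP->|/andP[wR _]]; first by rewrite eqxx.
  by rewrite (negPf (elim_root H wR)) andbF.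
- apply/setP => u; rewrite !inE negb_and negbK; apply/bigcupP/orP.
    move=> [w]; rewrite !inE => /orP[/eqP->|/andP[wR _]].
      by rewrite sub'v => /setU1P[->|/UA]; [left|right].
    by rewrite sub'R // => /(elim_sub H wR); right.
  case: (eqVneq u v) => [-> _|uv [//|]].
    by exists v; rewrite ?sub'v !inE eqxx.
  rewrite -in_setC -(elim_cover H) => /bigcupP[w wR uw].
  case: (boolP (e w v)) => wv.
    exists v; first by rewrite !inE eqxx.
    by rewrite sub'v inE; apply/orP; right; apply/UP; exists w.
  by exists w; rewrite ?sub'R // !inE wR wv orbT.
- have dis w u : w \in R -> ~~ e w v -> u \in sub' v -> u \in sub w -> False.
    rewrite sub'v => wR wv /setU1P[->|/UP[w' [w'R w'v uw']]] uw.
      by move: (vsub w wR); rewrite uw.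
    by move: wv; rewrite (elim_disjoint H wR w'R uw uw') w'v.
  move=> w w'; rewrite !inE => /orP[/eqP->|/andP[wR wv]] /orP[/eqP->|/andP[w'R w'v]] u //.
  + by rewrite (sub'R w') // => u1 u2; case: (dis w' u).
  + by rewrite (sub'R w) // => u1 u2; case: (dis w u).
  + by rewrite !sub'R //; apply: (elim_disjoint H).
- move=> w; rewrite !inE => /orP[/eqP->|/andP[wR wv]] a b;
    rewrite !inE => /andP[_ aA] /andP[_ bA]; first exact: sv.
  exact: (elim_clique H wR).
- move=> w; rewrite !inE => /orP[/eqP->|/andP[wR wv]] u u'.
    rewrite sub'v => /setU1P[->|/UP[w1 [wR wv uw]]] uu'.
      have u'v : u' != v by apply: contraTneq uu' => ->; rewrite e_irr.
      case: (boolP (u' \in A)) => u'A; first by right; rewrite !inE u'v.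
      left; rewrite inE; apply/orP; right; apply/UP.
      move: u'A; rewrite -in_setC -(elim_cover H) => /bigcupP[w1 wR u'w].
      exists w1; split=> //; rewrite e_sym in uu'.
      by case: (elim_nbr H wR u'w uu') => [|[]//]; rewrite (negPf (vsub w1 wR)).
    case: (elim_nbr H wR uw uu') => [u'w|[u'A wu']].
      by left; rewrite inE; apply/orP; right; apply/UP; exists w1.
    case: (eqVneq u' v) => [->|u'v]; first by left; rewrite setU11.
    (* [v] and [u'] are distinct neighbours in [A] of the old root [w1], hence adjacent. *)
    right; rewrite !inE u'v; split=> //.
    by apply: (elim_clique H wR) => //; rewrite eq_sym.
  rewrite sub'R // => uw uu'; case: (elim_nbr H wR uw uu') => [|[u'A wu']]; first by left.
  right; rewrite !inE u'A wu'; split=> //; rewrite andbT.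
  by apply: contraNneq wv => <-.
- move=> w; rewrite !inE => /orP[/eqP->|/andP[wR wv]] xs szx xsA; last first.
    rewrite sub'R // g'R //; apply: (elim_val H) => //.
    by apply: sub_all xsA => x; rewrite !inE => /orP[/andP[_ ->]//|->]; rewrite orbT.
  have xsA' : all (fun x => (x \in A) || (x == x0)) xs.
    by apply: sub_all xsA => x; rewrite !inE => /orP[/andP[_ ->]//|->]; rewrite orbT.
  have sR : [set w in R | e w v] \subset R by apply/subsetP => z; rewrite inE => /andP[].
  pose s xs := \sum_(w in [set w in R | e w v]) g w xs.
  have -> : g' v xs = dp_val D v s xs by apply: g'v.
  rewrite sub'v /dp_val.
  apply: (max_coloured_add (m0 := s xs) (m := fun j => s (set_nth x0 xs j v))) => //.
  + exact: elim_union H sR szx xsA'.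
  + move=> j jt; apply: elim_union H sR _ _.
      by rewrite size_set_nth szx; apply/maxn_idPr.
    apply/(all_nthP x0) => i; rewrite size_set_nth szx (maxn_idPr jt) => it.
    rewrite nth_set_nth /=; case: eqP => _; first by rewrite vA.
    by apply: (all_nthP x0 xsA'); rewrite szx.
  (* A boundary vertex with a neighbour in the block of [w'] is adjacent to [w'], and therefore to
     [v]. *)
  + move=> j jt xjv u uU.
    have : (nth x0 xs j \in A :\ v) || (nth x0 xs j == x0).
      by apply: (allP xsA); rewrite mem_nth // szx.
    case/orP => [|/eqP-> //]; rewrite !inE => /andP[xv xA].
    case/UP: uU => w' [wR wv uw]; apply/negP; rewrite e_sym => ux.
    case: (elim_nbr H wR uw ux) => [/(elim_sub H wR)|[_ wx]]; first by rewrite xA.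
    by move: xjv; rewrite (elim_clique H wR xA vA wx wv xv).
  + exact: leq_maxl.
  + move=> j jt vD xv; apply: leq_trans (leq_maxr _ _).
    by apply: leq_trans (leq_bigmax (Ordinal jt)); rewrite /= vD xv.
  + case: ltnP => [lt|_]; last by left.
    (* The maximum exceeds the value for [v] uncoloured, so it is positive and is not the 0 of a
       forbidden colour. *)
    right; have t0 : 0 < #|'I_t|.
      by rewrite card_ord; case: (t) lt => //; rewrite big_ord0.
    have [j Ej] := eq_bigmax (fun j : 'I_t => if (v \notin D) && ~~ e (nth x0 xs j) v
      then (s (set_nth x0 xs j v)).+1 else 0) t0.
    rewrite Ej in lt *; case: ifP lt => // /andP[vD xv] _.
    by exists j.
Qed.

(** * Optimality of the greedy deletion *)

Lemma colours_anti (D D' U : {set T}) xs c :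
  D \subset D' -> colours D' U xs c -> colours D U xs c.
Proof.
move=> /subsetP DD' [c1 c2]; split=> // u uU ut; have [uD xu] := c2 u uU ut.
by split=> //; apply: contra (DD' u) uD.
Qed.

(** An optimal colouring that avoids [D] must use every kept vertex, since an uncoloured one could
    be deleted as well without lowering the optimum. So the complement of [D] is colourable and has
    exactly the optimal size [m]. *)
Lemma peel_optimal (D : {set T}) m :
  max_coloured set0 setT (nseq t x0) m -> max_coloured D setT (nseq t x0) m ->
  (forall u c, u \notin D -> colours (u |: D) setT (nseq t x0) c ->
     #|coloured setT c| < m) ->
  (exists c, {in ~: D, forall u, c u < t} /\
     {in ~: D &, forall u u', c u = c u' -> ~~ e u u'}) /\
  (forall (S : {set T}) (c : T -> nat), {in S, forall u, c u < t} ->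
     {in S &, forall u u', c u = c u' -> ~~ e u u'} -> #|S| <= #|~: D|).
Proof.
move=> [_ le0] [[c [c1 c2] cm] _] peel.
have ct u : u \notin D -> c u < t.
  move=> uD; rewrite ltnNge; apply/negP => tu.
  suff /(peel u c uD) : colours (u |: D) setT (nseq t x0) c by rewrite cm ltnn.
  split=> // z _ zt; have [zD xz] := c2 z (in_setT _) zt; split=> //.
  by rewrite !inE negb_or zD andbT; apply: contraTneq zt => ->; rewrite -leqNgt.
have Dm : #|~: D| = m.
  rewrite -cm; apply: eq_card => u; rewrite !inE.
  by apply/idP/idP => [/ct//|ut]; case: (c2 u (in_setT _) ut).
split.
  exists c; split=> [u|u u']; rewrite ?inE; first exact: ct.
  by move=> /ct ut _; apply: c1.
move=> S c' lt ok; rewrite Dm.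
have <- : #|coloured setT (fun u => if u \in S then c' u else t)| = #|S|.
  apply: eq_card => u; rewrite !inE; case: ifP => [/lt->//|_]; exact: ltnn.
apply: le0; split=> [u u' _ _|u _]; last first.
  case: ifP => [uS ut|]; last by rewrite ltnn.
  by rewrite inE nth_nseq; split=> //; case: ifP.
case: ifP => [uS ut|]; last by rewrite ltnn.
by case: ifP => [u'S|_ ut']; [apply: ok | rewrite ut' ltnn in ut].
Qed.

End BoundedColouring.

(** * A structured language and its compilation *)

(** Variables are bound by sums, maxima, loops and [CLet] and are never reassigned; only the heap
    changes. Bounded quantifiers are sums tested for positivity. *)
Inductive expr :=
  | EConst of nat
  | EVar of nat
  | EAdd of expr & expr
  | ESub of expr & expr
  | ELoad of expr
  | EIf of expr & expr & expr
  | ESum of nat & expr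
  | EMax of nat & expr.

Fixpoint eval (N : nat) (h env : nat -> nat) (e : expr) : nat :=
  match e with
  | EConst k => k
  | EVar i => env i
  | EAdd a b => eval N h env a + eval N h env b
  | ESub a b => eval N h env a - eval N h env b
  | ELoad a => h (eval N h env a)
  | EIf c a b => if 0 < eval N h env c then eval N h env a else eval N h env b
  | ESum i a => \sum_(y < N) eval N h (set_reg env i y) a
  | EMax i a => \max_(y < N) eval N h (set_reg env i y) a
  end.

Inductive cmd :=
  | CSkip
  | CPut of expr & expr
  | CSeq of cmd & cmd
  | CIf of expr & cmd & cmd
  | CFor of nat & cmd
  | CLet of nat & expr & cmd
  | CPrint of expr.

Fixpoint run (N : nat) (env : nat -> nat) (c : cmd)
    (s : (nat -> nat) * seq bool) : (nat -> nat) * seq bool :=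
  match c with
  | CSkip => s
  | CPut a e =>
      (set_reg s.1 (eval N s.1 env a) (eval N s.1 env e), s.2)
  | CSeq c1 c2 => run N env c2 (run N env c1 s)
  | CIf e c1 c2 =>
      if 0 < eval N s.1 env e then run N env c1 s else run N env c2 s
  | CFor i c => iteri N (fun y => run N (set_reg env i y) c) s
  | CLet i e c => run N (set_reg env i (eval N s.1 env e)) c s
  | CPrint e => (s.1, rcons s.2 (0 < eval N s.1 env e))
  end.

(* Even registers form the evaluation stack, with [N] at the bottom; cell [a] of
   the heap is register [2 a + 1]. *)

(* The loop tests its condition at the end: [N] is always positive. *)
Definition loop_code (k l : nat) (body : seq instr) : seq instr :=
  IConst k.*2 0 :: body ++
  [:: IConst k.+1.*2 1; IAdd k.*2 k.*2 k.+1.*2; ISub k.+1.*2 0 k.*2;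
      IJump l.+1 k.+1.*2].

Definition heap_addr (d e : nat) : seq instr :=
  [:: IAdd d.*2 d.*2 d.*2; IConst e.*2 1; IAdd d.*2 d.*2 e.*2].

(** The branch for a zero condition comes first, since [IJump] is taken on a positive value. It ends
    with a jump made unconditional by loading 1 into the next stack level. *)
Definition if_code (d l : nat) (cc : seq instr) (ca cb : nat -> seq instr) :=
  let l1 := l + size cc in
  let b := cb l1.+1 in
  let l2 := l1 + (size b).+3 in
  let a := ca l2 in
  cc ++ IJump l2 d.*2 :: b ++
  [:: IConst d.+1.*2 1; IJump (l2 + size a) d.+1.*2] ++ a.

(** The value is left at stack level [d], [rho] gives the level of each variable, and [l] is the
    absolute address of the code, from which jump targets are computed. A maximum is updated as
    [m + (x - m)] with truncated subtraction. *)
Fixpoint ecode (rho : nat -> nat) (d l : nat) (e : expr) : seq instr :=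
  match e with
  | EConst k => [:: IConst d.*2 k]
  | EVar i => [:: IConst d.*2 0; IAdd d.*2 d.*2 (rho i).*2]
  | EAdd a b =>
      let ca := ecode rho d l a in
      ca ++ ecode rho d.+1 (l + size ca) b ++ [:: IAdd d.*2 d.*2 d.+1.*2]
  | ESub a b =>
      let ca := ecode rho d l a in
      ca ++ ecode rho d.+1 (l + size ca) b ++ [:: ISub d.*2 d.*2 d.+1.*2]
  | ELoad a => ecode rho d l a ++ heap_addr d d.+1 ++ [:: IGet d.*2 d.*2]
  | EIf c a b =>
      if_code d l (ecode rho d l c) (fun l => ecode rho d l a)
        (fun l => ecode rho d l b)
  | ESum i a =>
      IConst d.*2 0 :: loop_code d.+1 l.+1
        (ecode (set_reg rho i d.+1) d.+2 l.+2 a ++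
         [:: IAdd d.*2 d.*2 d.+2.*2])
  | EMax i a =>
      IConst d.*2 0 :: loop_code d.+1 l.+1
        (ecode (set_reg rho i d.+1) d.+2 l.+2 a ++
         [:: ISub d.+2.*2 d.+2.*2 d.*2; IAdd d.*2 d.*2 d.+2.*2])
  end.

(** A conditional is charged for both branches, which makes the bound independent of the memory. *)
Fixpoint ecost (N : nat) (e : expr) : nat :=
  match e with
  | EConst _ => 1
  | EVar _ => 2
  | EAdd a b | ESub a b => ecost N a + (ecost N b + 1)
  | ELoad a => ecost N a + 4
  | EIf c a b => ecost N c + (ecost N a + ecost N b + 3)
  | ESum _ a | EMax _ a => N * (ecost N a + 2 + 4) + 2
  end.

(** In [CPut] the address is completed with scratch level [d.+2], because level [d.+1] already holds
    the value to be stored. *)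
Fixpoint ccode (rho : nat -> nat) (d l : nat) (c : cmd) : seq instr :=
  match c with
  | CSkip => [::]
  | CPut a e =>
      let ca := ecode rho d l a in
      ca ++ ecode rho d.+1 (l + size ca) e ++ heap_addr d d.+2 ++
      [:: IPut d.*2 d.+1.*2]
  | CSeq c1 c2 =>
      let k := ccode rho d l c1 in k ++ ccode rho d (l + size k) c2
  | CIf e c1 c2 =>
      if_code d l (ecode rho d l e) (fun l => ccode rho d l c1)
        (fun l => ccode rho d l c2)
  | CFor i c => loop_code d l (ccode (set_reg rho i d) d.+1 l.+1 c)
  | CLet i e c =>
      let k := ecode rho d l e in
      k ++ ccode (set_reg rho i d) d.+1 (l + size k) c
  | CPrint e => ecode rho d l e ++ [:: IPrint d.*2]
  end.

Fixpoint ccost (N : nat) (c : cmd) : nat :=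
  match c with
  | CSkip => 0
  | CPut a e => ecost N a + (ecost N e + 4)
  | CSeq c1 c2 => ccost N c1 + ccost N c2
  | CIf e c1 c2 => ecost N e + (ccost N c1 + ccost N c2 + 3)
  | CFor _ c => N * (ccost N c + 4) + 1
  | CLet _ e c => ecost N e + ccost N c
  | CPrint e => ecost N e + 1
  end.

(** * Executions of compiled code with a step budget *)

Definition code_at (P : program) (l : nat) (code : seq instr) : Prop :=
  forall i a, onth code i = Some a -> onth P (l + i) = Some a.

Lemma onth_cat (T : Type) (s1 s2 : seq T) i :
  onth (s1 ++ s2) i = if i < size s1 then onth s1 i else onth s2 (i - size s1).
Proof. by elim: s1 i => [|x s1 IH] [|i] //=; rewrite IH. Qed.

Lemma onth_size (T : Type) (s : seq T) i a : onth s i = Some a -> i < size s.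
Proof. by elim: s i => [|x s IH] [|i] //= /IH. Qed.

Lemma code_at_catl P l c1 c2 : code_at P l (c1 ++ c2) -> code_at P l c1.
Proof. by move=> H i a E; apply: H; rewrite onth_cat (onth_size E). Qed.

Lemma code_at_catr P l c1 c2 :
  code_at P l (c1 ++ c2) -> code_at P (l + size c1) c2.
Proof.
move=> H i a E; rewrite -addnA; apply: H.
by rewrite onth_cat ltnNge leq_addr /= addKn.
Qed.

Lemma code_at_head P l a c : code_at P l (a :: c) -> onth P l = Some a.
Proof. by move=> H; rewrite -[l]addn0; apply: H. Qed.

Lemma code_at_behead P l a c : code_at P l (a :: c) -> code_at P l.+1 c.
Proof. by move=> H i b E; rewrite addSnnS; apply: H. Qed.

(** A Hoare triple with a time budget. The condition [Q] has to hold at some moment within the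
    budget, so budgets may be overestimates and compose by addition. *)
Definition runs (P : program) (B : nat) (c : config) (Q : config -> Prop) :=
  exists2 t, t <= B & Q (iter t (step P) c).

Lemma runs_seq P B1 B2 c (Q1 Q2 : config -> Prop) :
  runs P B1 c Q1 -> (forall c', Q1 c' -> runs P B2 c' Q2) ->
  runs P (B1 + B2) c Q2.
Proof.
move=> [t1 t1B H1] /(_ _ H1) [t2 t2B H2]; exists (t2 + t1).
  by rewrite addnC leq_add.
by rewrite iterD.
Qed.

Lemma runs_done P B c (Q : config -> Prop) : Q c -> runs P B c Q.
Proof. by exists 0. Qed.

Lemma runs_step P B l r x y a (Q : config -> Prop) :
  onth P l = Some a -> runs P B (exec (Config l r x y) a) Q ->
  runs P B.+1 (Config l r x y) Q.
Proof. by move=> E [t tB H]; exists t.+1 => //; rewrite iterSr /step /= E. Qed.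

Lemma runs_le P B B' c (Q : config -> Prop) : B <= B' -> runs P B c Q -> runs P B' c Q.
Proof. by move=> le [t tB H]; exists t => //; apply: leq_trans le. Qed.

Lemma set_reg_eq r i v : set_reg r i v i = v.
Proof. by rewrite /set_reg eqxx. Qed.

Lemma set_reg_neq r i j v : (j == i) = false -> set_reg r i v j = r j.
Proof. by rewrite /set_reg => ->. Qed.

Lemma eq_double i j : (i.*2 == j.*2) = (i == j).
Proof. by lia. Qed.

Definition heap_ok (h r : nat -> nat) := forall a, r a.*2.+1 = h a.
Definition env_ok (rho env r : nat -> nat) := forall i, r (rho i).*2 = env i.
Definition low_eq (d : nat) (r r' : nat -> nat) :=
  forall i, i < d -> r' i.*2 = r i.*2.

Lemma low_eq_trans d d' r1 r2 r3 :
  d <= d' -> low_eq d r1 r2 -> low_eq d' r2 r3 -> low_eq d r1 r3.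
Proof. by move=> dd' E1 E2 i id; rewrite E2 ?E1 //; lia. Qed.

Lemma env_ok_low d rho env r r' :
  (forall i, rho i < d) -> low_eq d r r' -> env_ok rho env r ->
  env_ok rho env r'.
Proof. by move=> lt E H i; rewrite E. Qed.

Lemma env_ok_bind d rho env r r' i y :
  (forall i, rho i < d) -> low_eq d r r' -> r' d.*2 = y -> env_ok rho env r ->
  env_ok (set_reg rho i d) (set_reg env i y) r'.
Proof.
by move=> lt E Ed H j; rewrite /set_reg; case: eqP => // _; rewrite E.
Qed.

Lemma bind_lt d d' (rho : nat -> nat) i :
  (forall i, rho i < d) -> d <= d' -> forall j, set_reg rho i d' j < d'.+1.
Proof. by move=> lt dd j; rewrite /set_reg; case: eqP => // _; have := lt j; lia. Qed.

(** The invariant has to be insensitive to stack levels from [k] on, because the loop control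
    overwrites levels [k] and [k.+1]. Each pass costs four instructions besides the body. *)
Lemma runs_loop P N k l body B inp (I : nat -> (nat -> nat) -> seq bool -> Prop)
    r out :
  0 < N -> 0 < k -> code_at P l (loop_code k l body) ->
  (forall y r r' o, I y r o ->
     low_eq k r r' -> (forall a, r' a.*2.+1 = r a.*2.+1) -> I y r' o) ->
  (forall y r o, y < N -> I y r o -> r 0 = N -> r k.*2 = y ->
     runs P B (Config l.+1 r inp o)
       (fun c => exists r' o', [/\ c = Config (l.+1 + size body) r' inp o',
          I y.+1 r' o', r' 0 = N & r' k.*2 = y])) ->
  r 0 = N -> I 0 r out ->
  runs P (N * (B + 4)).+1 (Config l r inp out)
    (fun c => exists r' o', [/\ c = Config (l + size (loop_code k l body)) r' inp o',
       I N r' o' & r' 0 = N]).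
Proof.
move=> N0 k0 A stab Hbody r0 I0.
have A1 := code_at_behead A; have A2 := code_at_catr A1.
apply: runs_step (code_at_head A) _; rewrite /=.
(* Induction on the number [m] of remaining passes, positive because the loop tests only at its
   end. *)
suff gen : forall m y r out, y + m = N -> 0 < m -> I y r out -> r 0 = N ->
    r k.*2 = y -> runs P (m * (B + 4)) (Config l.+1 r inp out)
    (fun c => exists r' o', [/\ c = Config (l + size (loop_code k l body)) r' inp o',
       I N r' o' & r' 0 = N]).
  apply: gen (add0n N) N0 _ _ (set_reg_eq _ _ _).
    by apply: stab I0 _ _ => [i ik|a]; rewrite set_reg_neq //; lia.
  by rewrite set_reg_neq //; lia.
elim=> // m IH {r0 I0}y {}r {}out Em _ Iy r0 ry.
have -> : m.+1 * (B + 4) = B + (m * (B + 4)).+4 by lia.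
apply: runs_seq (Hbody y r out _ Iy r0 ry) _; first by lia.
move=> _ [r' [o' [-> Iy' r'0 r'y]]].
apply: runs_step (code_at_head A2) _ => /=.
apply: runs_step (code_at_head (code_at_behead A2)) _ => /=.
apply: runs_step (code_at_head (code_at_behead (code_at_behead A2))) _ => /=.
apply: runs_step (code_at_head
  (code_at_behead (code_at_behead (code_at_behead A2)))) _ => /=.
set r1 := set_reg r' _ _; set r2 := set_reg r1 _ _; set r3 := set_reg r2 _ _.
have r2k : r2 k.*2 = y.+1.
  rewrite /r2 set_reg_eq /r1 set_reg_eq set_reg_neq; last by lia.
  by rewrite r'y addn1.
have r20 : r2 0 = N by rewrite /r2 set_reg_neq /r1 1?set_reg_neq //; lia.
have r3k : r3 k.*2 = y.+1 by rewrite /r3 set_reg_neq ?r2k //; lia.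
have r30 : r3 0 = N by rewrite /r3 set_reg_neq ?r20 //; lia.
(* The tested register holds the number of passes still to come, so the jump back is taken exactly
   when one remains. *)
have r3s : r3 k.*2.+2 = m by rewrite /r3 set_reg_eq r20 r2k; lia.
have I3 : I y.+1 r3 o'.
  by apply: stab Iy' _ _ => [i ik|a]; rewrite /r3 /r2 /r1 !set_reg_neq //; lia.
rewrite r3s; case: (posnP m) => m0.
  apply: runs_done; exists r3, o'; split=> //.
    by congr Config; rewrite /loop_code /= size_cat /=; lia.
  by have -> : N = y.+1 by lia.
by apply: (IH y.+1) => //; lia.
Qed.

(** For the branch laid out first, [Qa] is required after the jump over the other branch, which sets
    level [d.+1] to 1. *)
Lemma runs_if P d l cc ca cb Bc Ba Bb inp out r v (Qa : config -> Prop) :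
  let l1 := l + size cc in
  let b := cb l1.+1 in
  let l2 := l1 + (size b).+3 in
  let a := ca l2 in
  0 < d ->
  code_at P l (if_code d l cc ca cb) ->
  runs P Bc (Config l r inp out) (fun c => exists r',
    [/\ c = Config l1 r' inp out, r' d.*2 = v, low_eq d r r' &
        forall a, r' a.*2.+1 = r a.*2.+1]) ->
  (forall r', low_eq d r r' -> (forall a, r' a.*2.+1 = r a.*2.+1) ->
     code_at P l2 a -> 0 < v -> runs P Ba (Config l2 r' inp out) Qa) ->
  (forall r', low_eq d r r' -> (forall a, r' a.*2.+1 = r a.*2.+1) ->
     code_at P l1.+1 b -> (0 < v) = false -> runs P Bb (Config l1.+1 r' inp out)
       (fun c => exists r' o', c = Config (l1.+1 + size b) r' inp o' /\
         Qa (Config (l2 + size a) (set_reg r' d.+1.*2 1) inp o'))) ->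
  runs P (Bc + (Ba + Bb + 3)) (Config l r inp out) Qa.
Proof.
move=> l1 b l2 a d0 A Hc Ha Hb; apply: runs_seq Hc _ => _ [r' [-> r'd L H]].
have A1 := code_at_catr A; have A2 := code_at_behead A1.
have Ab := code_at_catl A2; have A3 := code_at_catr A2.
have Aa : code_at P l2 a.
  by have := code_at_catr (c1 := [:: _; _]) A3; rewrite -addnA addn2 addSnnS.
rewrite addn3; apply: runs_step (code_at_head A1) _; rewrite /= r'd.
case: ifP => v0; first by apply: runs_le (Ha _ L H Aa v0); lia.
have -> : (Ba + Bb).+2 = Bb + Ba.+2 by lia.
apply: runs_seq (Hb _ L H Ab v0) _ => _ [r1 [o1 [-> Q1]]].
apply: runs_step (code_at_head A3) _.
apply: runs_step (code_at_head (code_at_behead A3)) _.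
rewrite /= set_reg_eq /=.
by apply: runs_done.
Qed.

Lemma ecode_correct P N h e : 0 < N -> forall rho env d l r inp out,
  code_at P l (ecode rho d l e) -> r 0 = N -> 0 < d ->
  (forall i, rho i < d) -> env_ok rho env r -> heap_ok h r ->
  runs P (ecost N e) (Config l r inp out) (fun c => exists r',
    [/\ c = Config (l + size (ecode rho d l e)) r' inp out,
        r' d.*2 = eval N h env e, low_eq d r r' &
        forall a, r' a.*2.+1 = r a.*2.+1]).
Proof.
move=> N0; elim: e => [k|i|a IHa b IHb|a IHa b IHb|a IHa|c IHc a IHa b IHb|i a IHa|i a IHa]
  rho env d l r inp out /=.
all: set rr := r; move=> A r0 d0 lt He Hh.
- apply: runs_step (code_at_head A) _; apply: runs_done.
  exists (set_reg r d.*2 k); split=> [||j jd|a]; rewrite ?addn1 ?set_reg_eq //=.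
    by rewrite set_reg_neq //; lia.
  by rewrite set_reg_neq //; lia.
- apply: runs_step (code_at_head A) _ => /=.
  apply: runs_step (code_at_head (code_at_behead A)) _; apply: runs_done => /=.
  eexists; split=> [|||a].
  + by rewrite addn2.
  + by rewrite !set_reg_eq set_reg_neq; [rewrite He | have := lt i; lia].
  + by move=> j jd; rewrite !set_reg_neq //; lia.
  + by rewrite !set_reg_neq //; lia.
- apply: runs_seq (IHa rho env d l r inp out _ _ _ _ _ _) _ => //.
    exact: code_at_catl A.
  move=> _ [r1 [-> v1 L1 H1]]; have A1 := code_at_catr A.
  apply: runs_seq (IHb rho env d.+1 _ r1 inp out (code_at_catl A1) _ _ _ _ _) _ => //.
  + by have := L1 0 d0; rewrite /= => ->.
  + by move=> i; have := lt i; lia.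
  + exact: env_ok_low L1 He.
  + by move=> x; rewrite H1.
  move=> _ [r2 [-> v2 L2 H2]].
  apply: runs_step (code_at_head (code_at_catr A1)) _; apply: runs_done => /=.
  eexists; split=> [||j jd|x].
  + by rewrite !size_cat /= -!addnA !addnS !addn0.
  + by rewrite set_reg_eq v2 L2 ?v1.
  + by rewrite set_reg_neq ?L2 ?L1 //; lia.
  + by rewrite set_reg_neq ?H2 ?H1 //; lia.
- apply: runs_seq (IHa rho env d l r inp out _ _ _ _ _ _) _ => //.
    exact: code_at_catl A.
  move=> _ [r1 [-> v1 L1 H1]]; have A1 := code_at_catr A.
  apply: runs_seq (IHb rho env d.+1 _ r1 inp out (code_at_catl A1) _ _ _ _ _) _ => //.
  + by have := L1 0 d0; rewrite /= => ->.
  + by move=> i; have := lt i; lia.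
  + exact: env_ok_low L1 He.
  + by move=> x; rewrite H1.
  move=> _ [r2 [-> v2 L2 H2]].
  apply: runs_step (code_at_head (code_at_catr A1)) _; apply: runs_done => /=.
  eexists; split=> [||j jd|x].
  + by rewrite !size_cat /= -!addnA !addnS !addn0.
  + by rewrite set_reg_eq v2 L2 ?v1.
  + by rewrite set_reg_neq ?L2 ?L1 //; lia.
  + by rewrite set_reg_neq ?H2 ?H1 //; lia.
- apply: runs_seq (IHa rho env d l r inp out (code_at_catl A) _ _ _ _ _) _ => //.
  move=> _ [r1 [-> v1 L1 H1]]; have A1 := code_at_catr A.
  apply: runs_step (code_at_head A1) _ => /=.
  apply: runs_step (code_at_head (code_at_behead A1)) _ => /=.
  apply: runs_step (code_at_head (code_at_behead (code_at_behead A1))) _ => /=.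
  apply: runs_step (code_at_head (code_at_behead (code_at_behead (code_at_behead A1)))) _.
  apply: runs_done => /=.
  eexists; split=> [||j jd|x].
  + by rewrite !size_cat /= !addnS addn0.
  + rewrite set_reg_eq !set_reg_eq.
    rewrite (@set_reg_neq _ d.+1.*2 d.*2); last by lia.
    rewrite set_reg_eq v1 addnn addn1 !set_reg_neq ?H1 ?Hh //; lia.
  + by rewrite !set_reg_neq ?L1 //; lia.
  + by rewrite !set_reg_neq ?H1 //; lia.
- pose v := eval N h env c.
  apply: (@runs_if P d l _ _ _ _ _ _ inp out r v _ d0 A).
  + exact: IHc (code_at_catl A) _ _ _ _ _.
  + move=> r1 L1 H1 A1 v0.
      case: (IHa rho env d _ r1 inp out A1 _ _ _ _ _) => //.
    * by have := L1 0 d0; rewrite /= => ->.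
    * exact: env_ok_low L1 He.
    * by move=> x; rewrite H1.
    move=> t tB [r2 [E v2 L2 H2]]; exists t => //; exists r2; split.
    * rewrite E; congr Config.
      by rewrite /if_code !size_cat /= !size_cat /=; lia.
    * by rewrite v2 -/v v0.
    * exact: low_eq_trans L1 L2.
    * by move=> x; rewrite H2.
  + move=> r1 L1 H1 A1 v0.
    case: (IHb rho env d _ r1 inp out A1 _ _ _ _ _) => //.
    * by have := L1 0 d0; rewrite /= => ->.
    * exact: env_ok_low L1 He.
    * by move=> x; rewrite H1.
    move=> t tB [r2 [E v2 L2 H2]]; exists t => //; exists r2, out; split=> //.
    eexists; split.
    * congr Config.
      by rewrite /if_code !size_cat /= !size_cat /=; lia.
    * by rewrite set_reg_neq ?v2 -/v ?v0 //; lia.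
    * by move=> j jd; rewrite set_reg_neq ?(low_eq_trans _ L1 L2) //; lia.
    * by move=> x; rewrite set_reg_neq ?H2 //; lia.
(* Level [d] accumulates the partial sum, level [d.+1] is the counter, and the summand is computed
   at level [d.+2]. *)
- pose I y r' (o : seq bool) := [/\ o = out,
     r' d.*2 = \sum_(z < y) eval N h (set_reg env i z) a,
     low_eq d rr r' & forall a, r' a.*2.+1 = rr a.*2.+1].
  rewrite addn2; apply: runs_step (code_at_head A) _ => /=.
  have A1 := code_at_behead A; have A2 := code_at_behead A1.
  have A3 := code_at_catl A2.
  case: (@runs_loop P N d.+1 l.+1 _ (ecost N a + 2) inp I
    (set_reg r d.*2 0) out N0 _ A1) => //.
  + move=> y r1 r2 o [-> E1 E2 E3] L H; split=> //.
    * by rewrite L.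
    * by move=> j jd; rewrite L ?E2 //; lia.
    * by move=> x; rewrite H.
  + move=> y r1 o yN [-> E1 E2 E3] r10 r1k.
    apply: runs_seq (IHa _ (set_reg env i y) _ _ r1 inp out
      (code_at_catl A3) _ _ _ _ _) _ => //.
    * exact: (bind_lt _ lt (leqnSn d)).
    * move=> j; rewrite /set_reg; case: eqP => // _; rewrite E2 ?He //.
    * by move=> x; rewrite E3.
    move=> _ [r2 [-> v2 L2 H2]].
    apply: runs_step (code_at_head (code_at_catr A3)) _; apply: runs_done => /=.
    eexists; eexists; split.
    * by rewrite !size_cat /= addn1 addnS.
    * split=> //.
      - by rewrite set_reg_eq v2 L2 ?E1 ?big_ord_recr //; lia.
      - by move=> j jd; rewrite set_reg_neq ?L2 ?E2 //; lia.
      - by move=> x; rewrite set_reg_neq ?H2 ?E3 //; lia.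
    * rewrite set_reg_neq; last by lia.
      by have := L2 0; rewrite /= => ->.
    * by rewrite set_reg_neq ?L2 ?r1k //; lia.
  + by rewrite set_reg_neq //; lia.
  + split=> //.
    * by rewrite set_reg_eq big_ord0.
    * by move=> j jd; rewrite set_reg_neq //; lia.
    * by move=> x; rewrite set_reg_neq //; lia.
  move=> t tB [r1 [o [E [Eo E1 E2 E3] r10]]]; exists t => //.
  exists r1; split=> //; by rewrite E Eo addSnnS.
- pose I y r' (o : seq bool) := [/\ o = out,
     r' d.*2 = \max_(z < y) eval N h (set_reg env i z) a,
     low_eq d rr r' & forall a, r' a.*2.+1 = rr a.*2.+1].
  rewrite addn2; apply: runs_step (code_at_head A) _ => /=.
  have A1 := code_at_behead A; have A2 := code_at_behead A1.
  have A3 := code_at_catl A2.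
  case: (@runs_loop P N d.+1 l.+1 _ (ecost N a + 2) inp I
    (set_reg r d.*2 0) out N0 _ A1) => //.
  + move=> y r1 r2 o [-> E1 E2 E3] L H; split=> //.
    * by rewrite L.
    * by move=> j jd; rewrite L ?E2 //; lia.
    * by move=> x; rewrite H.
  + move=> y r1 o yN [-> E1 E2 E3] r10 r1k.
    apply: runs_seq (IHa _ (set_reg env i y) _ _ r1 inp out
      (code_at_catl A3) _ _ _ _ _) _ => //.
    * exact: (bind_lt _ lt (leqnSn d)).
    * move=> j; rewrite /set_reg; case: eqP => // _; rewrite E2 ?He //.
    * by move=> x; rewrite E3.
    move=> _ [r2 [-> v2 L2 H2]].
    have A4 := code_at_catr A3.
    apply: runs_step (code_at_head A4) _ => /=.
    apply: runs_step (code_at_head (code_at_behead A4)) _; apply: runs_done => /=.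
    eexists; eexists; split.
    * by rewrite !size_cat /= addn2 !addnS.
    * split=> //.
      - rewrite set_reg_eq set_reg_eq set_reg_neq; last by lia.
        by rewrite v2 L2 ?E1 ?big_ord_recr //= maxnE.
      - by move=> j jd; rewrite !set_reg_neq ?L2 ?E2 //; lia.
      - by move=> x; rewrite !set_reg_neq ?H2 ?E3 //; lia.
    * rewrite !set_reg_neq; try lia.
      by have := L2 0; rewrite /= => ->.
    * by rewrite !set_reg_neq ?L2 ?r1k //; lia.
  + by rewrite set_reg_neq //; lia.
  + split=> //.
    * by rewrite set_reg_eq big_ord0.
    * by move=> j jd; rewrite set_reg_neq //; lia.
    * by move=> x; rewrite set_reg_neq //; lia.
  move=> t tB [r1 [o [E [Eo E1 E2 E3] r10]]]; exists t => //.
  exists r1; split=> //; by rewrite E Eo addSnnS.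
Qed.

Lemma ccode_correct P N c : 0 < N -> forall rho env d l h r inp out,
  code_at P l (ccode rho d l c) -> r 0 = N -> 0 < d ->
  (forall i, rho i < d) -> env_ok rho env r -> heap_ok h r ->
  runs P (ccost N c) (Config l r inp out) (fun c' => exists r',
    [/\ c' = Config (l + size (ccode rho d l c)) r' inp
               (run N env c (h, out)).2,
        low_eq d r r' & heap_ok (run N env c (h, out)).1 r']).
Proof.
move=> N0; elim: c => [|a e|c1 IH1 c2 IH2|e c1 IH1 c2 IH2|i c IH|i e c IH|e]
  rho env d l h r inp out /=.
all: move=> A r0 d0 lt He Hh.
- by apply: runs_done; exists r; rewrite addn0.
- apply: runs_seq (ecode_correct N0 _ _ (code_at_catl A) r0 d0 lt He Hh) _.
  move=> _ [r1 [-> v1 L1 H1]]; have A1 := code_at_catr A.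
  have r10 : r1 0 = N by have := L1 0 d0; rewrite /= => ->.
  have lt1 i : rho i < d.+1 by have := lt i; lia.
  have Hh1 : heap_ok h r1 by move=> x; rewrite H1.
  apply: runs_seq (ecode_correct N0 _ _ (code_at_catl A1) r10 _ lt1
    (env_ok_low lt L1 He) Hh1) _ => //.
  move=> _ [r2 [-> v2 L2 H2]]; have A2 := code_at_catr A1.
  apply: runs_step (code_at_head A2) _ => /=.
  apply: runs_step (code_at_head (code_at_behead A2)) _ => /=.
  apply: runs_step (code_at_head (code_at_behead (code_at_behead A2))) _ => /=.
  apply: runs_step (code_at_head (code_at_behead (code_at_behead (code_at_behead A2)))) _.
  apply: runs_done => /=.
  have Ed : r2 d.*2 = eval N h env a by rewrite L2.
  set r3 := set_reg (set_reg (set_reg r2 _ _) _ _) _ _.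
  have E3 : r3 d.*2 = (eval N h env a).*2.+1.
    rewrite /r3 !set_reg_eq (@set_reg_neq _ d.*2.+4 d.*2); last by lia.
    by rewrite set_reg_eq Ed addnn addn1.
  have F3 x : (x == d.*2) = false -> (x == d.*2.+4) = false -> r3 x = r2 x.
    by move=> n1 n2; rewrite /r3 !set_reg_neq.
  eexists; split=> [|j jd|x].
  + by rewrite !size_cat /= !addnS addn0 -!addnA.
  + by rewrite E3 set_reg_neq ?F3 ?L2 ?L1 //; lia.
  + rewrite E3 /set_reg eqSS eq_double; case: eqP => // _.
      by rewrite F3 ?v2 //; lia.
    by rewrite F3 ?H2 ?H1 //; lia.
- apply: runs_seq (IH1 _ _ _ _ _ _ _ _ (code_at_catl A) r0 d0 lt He Hh) _.
  move=> _ [r1 [-> L1 H1]]; have A1 := code_at_catr A.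
  have r10 : r1 0 = N by have := L1 0 d0; rewrite /= => ->.
  case: (IH2 _ _ _ _ _ _ inp (run N env c1 (h, out)).2 A1 r10 d0 lt
    (env_ok_low lt L1 He) H1) => t tB.
  rewrite -surjective_pairing => -[r2 [E L2 H2]].
  exists t => //; exists r2; split=> //; first by rewrite E size_cat addnA.
  exact: low_eq_trans L1 L2.
- apply: (@runs_if P d l _ _ _ _ _ _ inp out r (eval N h env e) _ d0 A).
  + exact: ecode_correct (code_at_catl A) _ _ _ _ _.
  + move=> r1 L1 H1 A1 v0.
    have r10 : r1 0 = N by have := L1 0 d0; rewrite /= => ->.
    have Hh1 : heap_ok h r1 by move=> x; rewrite H1.
    case: (IH1 _ _ _ _ _ _ inp out A1 r10 d0 lt (env_ok_low lt L1 He) Hh1).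
    move=> t tB [r2 [E L2 H2]]; exists t => //; exists r2; rewrite v0; split=> //.
    * rewrite E; congr Config.
      by rewrite /if_code !size_cat /= !size_cat /=; lia.
    * exact: low_eq_trans L1 L2.
  + move=> r1 L1 H1 A1 v0.
    have r10 : r1 0 = N by have := L1 0 d0; rewrite /= => ->.
    have Hh1 : heap_ok h r1 by move=> x; rewrite H1.
    case: (IH2 _ _ _ _ _ _ inp out A1 r10 d0 lt (env_ok_low lt L1 He) Hh1).
    move=> t tB [r2 [E L2 H2]]; exists t => //.
    exists r2, (run N env c2 (h, out)).2; split=> //.
    exists (set_reg r2 d.+1.*2 1); rewrite v0; split.
    * congr Config.
      by rewrite /if_code !size_cat /= !size_cat /=; lia.
    * by move=> j jd; rewrite set_reg_neq ?(low_eq_trans _ L1 L2) //; lia.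
    * by move=> x; rewrite set_reg_neq ?H2 //; lia.
(* [S y] is the state that the semantics assigns after [y] passes; the invariant compares the
   machine with it. *)
- pose S y := iteri y (fun y => run N (set_reg env i y) c) (h, out).
  pose I y r' o := [/\ o = (S y).2, low_eq d r r' & heap_ok (S y).1 r'].
  have A1 := code_at_catl (code_at_behead A).
  rewrite addn1; case: (@runs_loop P N d l _ (ccost N c) inp I r out N0 d0 A) => //.
  + move=> y r1 r2 o [-> E1 E2] L H; split=> //.
    * by move=> j jd; rewrite L ?E1.
    * by move=> x; rewrite H.
  + move=> y r1 o yN [-> L1 H1] r10 r1k.
    case: (IH _ (set_reg env i y) _ _ _ _ inp (S y).2 A1 r10 _ _ _ H1) => //.
    * exact: (bind_lt _ lt (leqnn d)).
    * exact: env_ok_bind L1 r1k He.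
    move=> t tB; rewrite -surjective_pairing => -[r2 [E L2 H2]].
    exists t => //; exists r2, (S y.+1).2; split=> //.
    * by split=> // j jd; rewrite L2 ?L1 //; lia.
    * by have := L2 0; rewrite /= => ->.
    * by rewrite L2.
  move=> t tB [r1 [o [E [Eo E1 E2] r10]]]; exists t => //.
  by exists r1; rewrite E Eo.
- apply: runs_seq (ecode_correct N0 _ _ (code_at_catl A) r0 d0 lt He Hh) _.
  move=> _ [r1 [-> v1 L1 H1]]; have A1 := code_at_catr A.
  have r10 : r1 0 = N by have := L1 0 d0; rewrite /= => ->.
  have Hh1 : heap_ok h r1 by move=> x; rewrite H1.
  have He1 := env_ok_bind i lt L1 v1 He.
  case: (IH _ _ _ _ _ _ inp out A1 r10 _ (bind_lt _ lt (leqnn d)) He1 Hh1) => //.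
  move=> t tB [r2 [E L2 H2]]; exists t => //; exists r2; split=> //.
    by rewrite E size_cat addnA.
  by apply: low_eq_trans L1 L2.
- apply: runs_seq (ecode_correct N0 _ _ (code_at_catl A) r0 d0 lt He Hh) _.
  move=> _ [r1 [-> v1 L1 H1]]; have A1 := code_at_catr A.
  apply: runs_step (code_at_head A1) _; apply: runs_done => /=.
  exists r1; split=> //; last by move=> x; rewrite H1.
  by rewrite v1 size_cat addn1 addnS.
Qed.

(** * Polynomial cost, and the input phase *)

Definition poly_bounded (f : nat -> nat) : Prop :=
  exists c k, forall N, 0 < N -> f N <= c * N ^ k.

Lemma poly_bounded_const c : poly_bounded (fun=> c).
Proof. by exists c, 0 => N _; rewrite expn0 muln1. Qed.

Lemma poly_boundedD f g :
  poly_bounded f -> poly_bounded g -> poly_bounded (fun N => f N + g N).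
Proof.
move=> [c1 [k1 H1]] [c2 [k2 H2]]; exists (c1 + c2), (k1 + k2) => N N0.
rewrite mulnDl leq_add //.
  by apply: leq_trans (H1 N N0) _; rewrite leq_mul2l leq_pexp2l ?leq_addr ?orbT.
by apply: leq_trans (H2 N N0) _; rewrite leq_mul2l leq_pexp2l ?leq_addl ?orbT.
Qed.

Lemma poly_boundedM f : poly_bounded f -> poly_bounded (fun N => N * f N).
Proof.
move=> [c [k H]]; exists c, k.+1 => N N0.
by rewrite expnS mulnCA leq_mul2l H ?orbT.
Qed.

Lemma ecost_poly e : poly_bounded (ecost^~ e).
Proof.
elim: e => [k|i|a IHa b IHb|a IHa b IHb|a IHa|c IHc a IHa b IHb|i a IHa|i a IHa] /=;
  by do ?[exact: poly_bounded_const | assumption | apply: poly_boundedD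
         | apply: poly_boundedM].
Qed.

Lemma ccost_poly c : poly_bounded (ccost^~ c).
Proof.
elim: c => [|a e|c1 IH1 c2 IH2|e c1 IH1 c2 IH2|i c IH|i e c IH|e] /=;
  by do ?[exact: poly_bounded_const | assumption | exact: ecost_poly
         | apply: poly_boundedD | apply: poly_boundedM].
Qed.

(** Register 0 counts the bits, and each bit is stored in the heap cell of its index. The end of the
    input is the only case where the value read minus 1 is positive. The last two instructions add
    the 4 in [N]. *)
Definition read_code : seq instr :=
  [:: IRead 2; IConst 4 1; ISub 6 2 4; IJump 9 6; IAdd 6 0 0; IAdd 6 6 4;
      IPut 6 2; IAdd 0 0 4; IJump 0 4; IConst 4 4; IAdd 0 0 4].

Definition heap_of (w : seq bool) : nat -> nat :=
  fun a => nth 0 (map nat_of_bool w) a.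

Lemma read_code_correct P w : code_at P 0 read_code ->
  runs P (9 * size w + 6) (initial w) (fun c => exists r,
    [/\ c = Config 11 r [::] [::], r 0 = size w + 4 & heap_ok (heap_of w) r]).
Proof.
move=> A.
(* [w1] is the part already stored and [w2] the part still to be read. *)
suff gen : forall w2 w1 r, r 0 = size w1 -> heap_ok (heap_of w1) r ->
    runs P (9 * size w2 + 6) (Config 0 r w2 [::]) (fun c => exists r,
    [/\ c = Config 11 r [::] [::], r 0 = size (w1 ++ w2) + 4 &
        heap_ok (heap_of (w1 ++ w2)) r]).
  by apply: (gen w [::]) => // a; rewrite /heap_of nth_nil.
have A1 := code_at_behead A; have A2 := code_at_behead A1.
have A3 := code_at_behead A2; have A4 := code_at_behead A3.
have A5 := code_at_behead A4; have A6 := code_at_behead A5.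
have A7 := code_at_behead A6; have A8 := code_at_behead A7.
have A9 := code_at_behead A8; have A10 := code_at_behead A9.
elim=> [|b w2 IH] w1 r r0 Hh.
  rewrite /= cats0.
  apply: runs_step (code_at_head A) _ => /=.
  apply: runs_step (code_at_head A1) _ => /=.
  apply: runs_step (code_at_head A2) _ => /=.
  apply: runs_step (code_at_head A3) _ => /=.
  apply: runs_step (code_at_head A9) _ => /=.
  apply: runs_step (code_at_head A10) _ => /=.
  apply: runs_done; eexists; split=> //; first by rewrite /set_reg /= r0.
  by move=> a; rewrite -Hh !set_reg_neq //; lia.
have -> : 9 * size (b :: w2) + 6 = (9 * size w2 + 6).+4.+4.+1 by rewrite /=; lia.
apply: runs_step (code_at_head A) _ => /=.
apply: runs_step (code_at_head A1) _ => /=.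
apply: runs_step (code_at_head A2) _ => /=.
apply: runs_step (code_at_head A3) _ => /=.
rewrite set_reg_eq ifF; last by rewrite /set_reg /=; case: (b).
apply: runs_step (code_at_head A4) _ => /=.
apply: runs_step (code_at_head A5) _ => /=.
apply: runs_step (code_at_head A6) _ => /=.
apply: runs_step (code_at_head A7) _ => /=.
apply: runs_step (code_at_head A8) _ => /=.
set r1 := set_reg (set_reg _ 6 _) 6 _.
have E6 : r1 6 = (size w1).*2.+1 by rewrite /r1 /set_reg /= r0 addnn addn1.
rewrite E6; set r2 := set_reg r1 _ _.
have E2 x : r2 x.*2 = r1 x.*2 by rewrite /r2 set_reg_neq //; lia.
have -> : 0 < set_reg r2 0 (r2 0 + r2 4) 4.
  by rewrite set_reg_neq // (E2 2) /r1 /set_reg.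
have -> : w1 ++ b :: w2 = rcons w1 b ++ w2 by rewrite cat_rcons.
apply: IH; first by rewrite set_reg_eq size_rcons -r0 (E2 0) (E2 2) /r1 /set_reg /= addn1.
move=> a; rewrite /heap_of map_rcons nth_rcons size_map.
have E1 : r1 a.*2.+1 = heap_of w1 a by rewrite /r1 !set_reg_neq ?Hh //; lia.
rewrite set_reg_neq // /r2 /set_reg eqSS eq_double E1.
case: ltngtP => // aw.
by rewrite /heap_of nth_default // size_map ltnW.
Qed.

Lemma compile_correct (c : cmd) : exists P b k, forall w : seq bool,
  let N := size w + 4 in
  exists2 t, t <= b * size w ^ k + b &
    computes_in P w t (run N (fun=> N) c (heap_of w, [::])).2.
Proof.
have [b [k H]] := ccost_poly c.
(* Every variable starts at stack level 0 and so has the value [N]; code generation starts at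
   address 11, the length of [read_code]. *)
pose P := read_code ++ ccode (fun=> 0) 1 11 c.
have A0 : code_at P 0 P by [].
have A1 := code_at_catl A0; have A2 := code_at_catr A0.
(* For nonempty [w], [N] is at most [5 * size w], and 15 is 9 + 6 from the time for reading. The
   exponent is raised so that linear reading time fits even when [k] is 0; the additive constant
   covers empty input. *)
exists P, (b * 5 ^ k + 15), k.+1 => w N.
have N0 : 0 < N by rewrite /N addn4.
suff [t tB [r [E _ _]]] : runs P (9 * size w + 6 + ccost N c) (initial w)
    (fun c' => exists r', [/\ c' = Config (size P) r' [::]
               (run N (fun=> N) c (heap_of w, [::])).2,
        low_eq 0 r' r' & heap_ok (run N (fun=> N) c (heap_of w, [::])).1 r']).
  exists t; last by rewrite /computes_in E.
  apply: leq_trans tB _; have := H N N0.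
  rewrite /N; case: (size w) => [|m] Hm.
    rewrite muln0 exp0n // muln0 !add0n addnC leq_add //.
    apply: leq_trans Hm _; rewrite leq_mul2l; apply/orP; right.
    by case: (k) => // k'; rewrite leq_exp2r.
  have le1 : m.+1 <= m.+1 ^ k.+1 by rewrite -{1}[m.+1]expn1 leq_pexp2l.
  have le2 : (m.+1 + 4) ^ k <= 5 ^ k * m.+1 ^ k.+1.
    apply: (@leq_trans ((5 * m.+1) ^ k)).
      case: (k) => // k'; rewrite leq_exp2r //; lia.
    by rewrite expnMn leq_mul2l leq_pexp2l ?orbT.
  apply: leq_trans (leq_addr _ _); rewrite mulnDl addnC leq_add //.
    by apply: leq_trans Hm _; rewrite -mulnA leq_mul2l le2 orbT.
  by apply: (@leq_trans (15 * m.+1)); [lia | rewrite leq_mul2l le1 orbT].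
apply: runs_seq (read_code_correct w A1) _ => _ [r [-> r0 Hh]].
case: (@ccode_correct P N c N0 _ (fun=> N) _ _ _ r [::] [::] A2 r0 _ _ _ Hh) => //.
by move=> t tB [r' [E L H']]; exists t => //; exists r'; split=> //; rewrite E size_cat.
Qed.

(** * The program *)

Fixpoint binds (env : nat -> nat) (vs zs : seq nat) : nat -> nat :=
  match vs, zs with
  | x :: vs', z :: zs' => binds (set_reg env x z) vs' zs'
  | _, _ => env
  end.

Lemma binds_notin env vs zs i : i \notin vs -> binds env vs zs i = env i.
Proof.
elim: vs env zs => [|x vs IH] env [|z zs] //=; rewrite in_cons negb_or.
by move=> /andP[ix ivs]; rewrite IH // set_reg_neq // (negPf ix).
Qed.

Lemma map_binds env vs zs :
  uniq vs -> size zs = size vs -> map (binds env vs zs) vs = zs.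
Proof.
elim: vs env zs => [|x vs IH] env [|z zs] //= /andP[xvs U] [sz].
by rewrite binds_notin // set_reg_eq IH.
Qed.

Lemma map_set_reg env i v vs : i \notin vs -> map (set_reg env i v) vs = map env vs.
Proof.
move=> ivs; apply/eq_in_map => j jvs; rewrite set_reg_neq //.
by apply: contraNF ivs => /eqP <-.
Qed.

Lemma iteri_ind (S : Type) (f : nat -> S -> S) (I : nat -> S -> Prop) N s :
  I 0 s -> (forall y s, y < N -> I y s -> I y.+1 (f y s)) -> I N (iteri N f s).
Proof.
move=> I0; elim: N => //= N IH IS; apply: (IS) => //; apply: IH => y s' yN.
by apply: IS; apply: ltnW.
Qed.

(** A numeral in base [N] behind a leading 1. The leading digit separates keys of different lengths
    and keeps nonempty keys away from the cells below [N]. *)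
Definition addr (N : nat) (s : seq nat) : nat := foldl (fun b x => b * N + x) 1 s.

Lemma addr_rcons N s x : addr N (rcons s x) = addr N s * N + x.
Proof. by rewrite /addr foldl_rcons. Qed.

Lemma addr_gt0 N s : 0 < N -> 0 < addr N s.
Proof.
move=> N0; elim/last_ind: s => // s x IH; rewrite addr_rcons.
by rewrite addn_gt0 muln_gt0 IH N0.
Qed.

Lemma addr_ge N s : 0 < N -> s != [::] -> N <= addr N s.
Proof.
move=> N0; case/lastP: s => // s x _; rewrite addr_rcons.
by apply: leq_trans (leq_addr _ _); rewrite leq_pmull // addr_gt0.
Qed.

Lemma addr_inj N s s' : 1 < N -> all (ltn^~ N) s -> all (ltn^~ N) s' ->
  addr N s = addr N s' -> s = s'.
Proof.
move=> N1; have N0 : 0 < N by lia.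
have ne r y : addr N (rcons r y) != 1.
  have := @addr_ge N (rcons r y) N0; rewrite -size_eq0 size_rcons => /(_ isT).
  by lia.
elim/last_ind: s s' => [|s x IH] s'.
  by case/lastP: s' => // s' x' _ _ /esym/eqP; rewrite (negPf (ne _ _)).
case/lastP: s' => [_ _ /eqP|s' x']; first by rewrite (negPf (ne _ _)).
rewrite !all_rcons !addr_rcons => /andP[xN sN] /andP[x'N s'N] E.
have Es : addr N s = addr N s'.
  by have := congr1 (divn^~ N) E; rewrite !divnMDl // !divn_small // !addn0.
have Ex : x = x' by move: E; rewrite Es; lia.
by rewrite Ex (IH s').
Qed.

(** Multiplication by [N] is a sum of [N] equal terms. Its dummy variable is 0, which therefore may
    not occur among [vs]. *)
Definition eaddr (k : nat) (vs : seq nat) : expr :=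
  foldl (fun b i => EAdd (ESum 0 b) (EVar i))
    (EAdd (ESum 0 (EConst 1)) (EConst k)) vs.

Lemma sum_const_ord N m : \sum_(y < N) m = m * N.
Proof. by rewrite sum_nat_const card_ord mulnC. Qed.

Lemma eval_eaddr N h env k vs : 0 \notin vs ->
  eval N h env (eaddr k vs) = addr N (k :: map env vs).
Proof.
elim/last_ind: vs env => [|vs x IH] env.
  by rewrite /= sum_const_ord /addr /=.
rewrite mem_rcons in_cons negb_or => /andP[_ vs0].
rewrite /eaddr foldl_rcons /= -/(eaddr k vs) map_rcons -rcons_cons addr_rcons.
rewrite -(sum_const_ord N); congr addn; apply: eq_bigr => y _.
by rewrite IH // map_set_reg.
Qed.

(** Adds [j] once for each number below [i], which is correct as long as the value of [i] is at most
    [N]. *)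
Definition EMul (i j : nat) : expr :=
  ESum 9 (EIf (ESub (EVar i) (EVar 9)) (EVar j) (EConst 0)).

Lemma sum_ltn_ord N x m : x <= N ->
  \sum_(z < N) (if z < x then m else 0) = x * m.
Proof.
move=> xN; rewrite -big_mkcond -(big_ord_widen _ (fun=> m)) //.
by rewrite sum_nat_const card_ord.
Qed.

Lemma eval_EMul N h env i j : i != 9 -> j != 9 -> env i <= N ->
  eval N h env (EMul i j) = env i * env j.
Proof.
move=> i9 j9 iN /=; rewrite -(sum_ltn_ord _ iN); apply: eq_bigr => z _.
by rewrite set_reg_eq !set_reg_neq ?(negPf i9) ?(negPf j9) // subn_gt0.
Qed.

Definition EAnd (a b : expr) := EIf a b (EConst 0).
Definition ENot (a : expr) := EIf a (EConst 0) (EConst 1).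

(* Variables: 1 holds the number [n] of vertices, 2 an isolated vertex, 3 the
   vertex under test, 5 the vertex being eliminated, 10, 11, ... a tuple of
   vertices indexed by colours; 6, 7, 8, 9 and 0 are bound locally.
   Tables: 0 is the set of deleted vertices, 1 the status of a vertex (0 when
   remaining, 2 when it is a root, 1 otherwise), 2 the dynamic programming
   table, 3 the optimum without deletions. *)
Definition EAdj (i j : nat) : expr :=
  EAnd (ESub (EVar 1) (EVar i))
    (EAnd (ESub (EVar 1) (EVar j)) (ELoad (EAdd (EMul i 1) (EVar j)))).

Definition EDeleted i := ELoad (eaddr 0 [:: i]).
Definition EStatus i := ELoad (eaddr 1 [:: i]).
Definition ERoot i := ESub (EStatus i) (EConst 1).

(** Counts the pairs of distinct nonadjacent remaining neighbours and requires the count to be zero.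
    The two truncated differences add up to the distance, positive exactly for distinct vertices. *)
Definition ESimplicial (i : nat) : expr :=
  EAnd (ENot (EStatus i))
    (ENot (ESum 7 (ESum 8
      (EAnd (ENot (EStatus 7)) (EAnd (ENot (EStatus 8))
      (EAnd (EAdj i 7) (EAnd (EAdj i 8)
      (EAnd (EAdd (ESub (EVar 7) (EVar 8)) (ESub (EVar 8) (EVar 7)))
            (ENot (EAdj 7 8)))))))))).

Definition EBlocks (ys : seq nat) : expr :=
  ESum 6 (EIf (EAnd (ERoot 6) (EAdj 6 5)) (ELoad (eaddr 2 (6 :: ys)))
    (EConst 0)).

Definition EColour (xs : seq nat) (j : nat) : expr :=
  EIf (EDeleted 5) (EConst 0) (EIf (EAdj (nth 0 xs j) 5) (EConst 0)
    (EAdd (EConst 1) (EBlocks (set_nth 0 xs j 5)))).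

(** The expression for [dp_val], unrolled over the colours because a colour is the name of a
    variable. Each unrolling duplicates the previous expression, which is harmless since [t] is
    fixed. *)
Fixpoint EBody (xs : seq nat) (k : nat) : expr :=
  if k is k'.+1 then
    EAdd (EBody xs k') (ESub (EColour xs k') (EBody xs k'))
  else EBlocks xs.

Definition CFors (vs : seq nat) (c : cmd) : cmd := foldr CFor c vs.

(** The pivot is the last simplicial vertex, found as the maximum of index plus one, with 0 for the
    other vertices. Its table row is filled before the statuses change, because the recurrence reads
    the old roots. *)
Definition CRound (t : nat) : cmd :=
  let xs := iota 10 t in
  CLet 5 (ESub (EMax 5 (EIf (ESimplicial 5) (EAdd (EVar 5) (EConst 1))
                          (EConst 0))) (EConst 1))
  (CSeq (CFors xs (CPut (eaddr 2 (5 :: xs)) (EBody xs t)))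
  (CSeq (CFor 6 (CIf (EAnd (ERoot 6) (EAdj 6 5))
                   (CPut (eaddr 1 [:: 6]) (EConst 1)) CSkip))
        (CPut (eaddr 1 [:: 5]) (EConst 2)))).

(** Each round eliminates one vertex and the padding is eliminated too, so [N] rounds exhaust the
    graph. *)
Definition COptimum (t : nat) : cmd :=
  CSeq (CFor 6 (CPut (eaddr 1 [:: 6]) (EConst 0))) (CFor 4 (CRound t)).

Definition EOptimum (t : nat) : expr :=
  ESum 6 (EIf (ERoot 6) (ELoad (eaddr 2 (6 :: nseq t 2))) (EConst 0)).

(** The number of vertices is recovered from [N - 4 = n * n] as the number of [z] whose successor
    has a square of at most [N - 4]. The isolated vertex is [N - 1]. A tentative deletion is undone
    when the optimum falls below the one stored in table 3. *)
Definition CMain (t : nat) : cmd :=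
  CLet 1 (ESum 8 (ENot (ESub (EAdd (EMul 8 8) (EAdd (EVar 8)
                                (EAdd (EVar 8) (EConst 1))))
                          (ESub (ESum 0 (EConst 1)) (EConst 4)))))
  (CLet 2 (ESub (ESum 0 (EConst 1)) (EConst 1))
  (CSeq (COptimum t)
  (CSeq (CPut (eaddr 3 [::]) (EOptimum t))
  (CSeq (CFor 3 (CSeq (CPut (eaddr 0 [:: 3]) (EConst 1))
                (CSeq (COptimum t)
                      (CIf (ESub (ELoad (eaddr 3 [::])) (EOptimum t))
                         (CPut (eaddr 0 [:: 3]) (EConst 0)) CSkip))))
        (CFor 3 (CIf (ESub (EVar 1) (EVar 3)) (CPrint (EDeleted 3)) CSkip)))))).

(** * Correctness of the program *)

Section Correctness.

Variables (N n t : nat) (a : nat -> nat -> bool).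
Hypothesis nN : n * n + 4 = N.

Let e : rel 'I_N := fun x y => [&& x < n, y < n & a x y].

Hypotheses (e_sym : symmetric e) (e_irr : irreflexive e).
Hypothesis e_elim : simplicial_elimination e.

Let n_lt : n < N. Proof. by rewrite -nN; nia. Qed.
Let N_gt3 : 3 < N. Proof. by rewrite -nN; lia. Qed.
Let N_gt1 : 1 < N. Proof. by lia. Qed.
Let N_gt0 : 0 < N. Proof. by lia. Qed.
Let pad_lt : N.-1 < N. Proof. by lia. Qed.
Let pad : 'I_N := Ordinal pad_lt.

Let pad_isolated u : ~~ e pad u.
Proof. by rewrite /e /= ltnNge; have -> : n <= N.-1 by rewrite -nN; nia. Qed.

Let valid (s : seq nat) := all (ltn^~ N) s.

Definition holds_input (h : nat -> nat) :=
  forall x y, x < n -> y < n -> h (x * n + y) = a x y.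

Lemma put_addr h s s' v : valid s -> valid s' ->
  set_reg h (addr N s) v (addr N s') = if s' == s then v else h (addr N s').
Proof.
move=> vs vs'; rewrite /set_reg; case: (eqVneq s' s) => [->|ss]; first by rewrite eqxx.
by rewrite ifF //; apply: contraNF ss => /eqP/(addr_inj N_gt1 vs' vs) ->.
Qed.

Lemma holds_input_put h s v : s != [::] -> holds_input h ->
  holds_input (set_reg h (addr N s) v).
Proof.
move=> s0 H x y xn yn; rewrite set_reg_neq ?H //; apply: ltn_eqF.
apply: leq_trans (addr_ge N_gt0 s0); rewrite -nN; nia.
Qed.

(** The predicate [p] describes the keys that may have been overwritten. *)
Definition frame (p : pred (seq nat)) (h h' : nat -> nat) :=
  (holds_input h -> holds_input h') /\
  forall s, valid s -> ~~ p s -> h' (addr N s) = h (addr N s).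

Lemma frame_refl p h : frame p h h.
Proof. by []. Qed.

Lemma frame_sub (p q : pred (seq nat)) h1 h2 :
  subpred p q -> frame p h1 h2 -> frame q h1 h2.
Proof. by move=> pq [i f]; split=> // s vs qs; apply: f (contra (pq s) qs). Qed.

Lemma frame_trans p h1 h2 h3 : frame p h1 h2 -> frame p h2 h3 -> frame p h1 h3.
Proof.
by move=> [i1 f1] [i2 f2]; split=> [/i1/i2//|s vs ps]; rewrite f2 ?f1.
Qed.

Lemma frame_put (p : pred (seq nat)) h s v :
  s != [::] -> valid s -> p s -> frame p h (set_reg h (addr N s) v).
Proof.
move=> s0 vs ps; split=> [|s' vs' ps']; first exact: holds_input_put.
by rewrite put_addr //; case: eqP => // E; rewrite E ps in ps'.
Qed.

(** * Values of the expressions *)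

Lemma eval_EAdj (h env : nat -> nat) i j (x y : 'I_N) :
  holds_input h -> env 1 = n -> i != 9 -> j != 9 -> env i = x -> env j = y ->
  eval N h env (EAdj i j) = e x y.
Proof.
move=> H e1 i9 j9 ix jy; have := @eval_EMul N h env i 1 i9 isT.
rewrite /EAdj /EAnd; move: (EMul i 1) => M; rewrite /= ix jy e1 => ->; last first.
  exact: ltnW.
rewrite !subn_gt0 /e; case: ltnP => //= xn; case: ltnP => //= yn.
exact: H.
Qed.

Record rep (h : nat -> nat) (D A R : {set 'I_N}) : Prop := Rep {
  rep_input : holds_input h;
  rep_deleted : forall w : 'I_N, h (addr N [:: 0; val w]) = (w \in D);
  rep_status : forall w : 'I_N, h (addr N [:: 1; val w]) =
    if w \in A then 0 else if w \in R then 2 else 1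
}.

Definition table (h : nat -> nat) (w : 'I_N) (xs : seq 'I_N) : nat :=
  h (addr N (2 :: val w :: map val xs)).

Lemma eval_load_addr (h env : nat -> nat) k vs : 0 \notin vs ->
  eval N h env (ELoad (eaddr k vs)) = h (addr N (k :: map env vs)).
Proof. by move=> v0; rewrite [LHS]/= eval_eaddr. Qed.

Lemma eval_EStatus (h env : nat -> nat) D A R i (w : 'I_N) : rep h D A R -> i != 0 ->
  env i = w -> (0 < eval N h env (EStatus i)) = (w \notin A).
Proof.
move=> H i0 iw; rewrite eval_load_addr ?inE 1?eq_sym //= iw (rep_status H).
by case: ifP => // _; case: ifP.
Qed.

Lemma eval_ERoot (h env : nat -> nat) D A R i (w : 'I_N) :
  rep h D A R -> [disjoint R & A] -> i != 0 -> env i = w -> (0 < eval N h env (ERoot i)) = (w \in R).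
Proof.
move=> H RA i0 iw; rewrite /ERoot; have E := @eval_load_addr h env 1 [:: i].
rewrite -/(EStatus i) in E; move: (EStatus i) E => M E; rewrite /= {}E; last first.
  by rewrite inE eq_sym.
rewrite /= iw (rep_status H); case: ifP => [wA|_]; last by case: ifP.
by apply/esym/negbTE; apply: contraL wA => /(disjointFr RA) ->.
Qed.

Lemma eval_EAnd (h env : nat -> nat) b c :
  (0 < eval N h env (EAnd b c)) = (0 < eval N h env b) && (0 < eval N h env c).
Proof. by rewrite /=; case: ifP. Qed.

Lemma eval_ENot (h env : nat -> nat) b :
  (0 < eval N h env (ENot b)) = ~~ (0 < eval N h env b).
Proof. by rewrite /=; case: ifP. Qed.

Lemma sum_gt0P (F : 'I_N -> nat) :
  reflect (exists y, 0 < F y) (0 < \sum_(y < N) F y).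
Proof.
rewrite lt0n sum_nat_eq0 negb_forall; apply: (iffP existsP) => -[y Fy]; exists y;
  by move: Fy; rewrite /= lt0n.
Qed.

Lemma eval_ESum (h env : nat -> nat) i b :
  eval N h env (ESum i b) = \sum_(y < N) eval N h (set_reg env i y) b.
Proof. by []. Qed.

Lemma eval_EIf (h env : nat -> nat) c b1 b2 :
  eval N h env (EIf c b1 b2) =
  if 0 < eval N h env c then eval N h env b1 else eval N h env b2.
Proof. by []. Qed.

Lemma eval_EAdd (h env : nat -> nat) b c :
  eval N h env (EAdd b c) = eval N h env b + eval N h env c.
Proof. by []. Qed.

Lemma eval_ESimplicial (h env : nat -> nat) D A R (v : 'I_N) : rep h D A R -> env 1 = n ->
  env 5 = v -> reflect (v \in A /\ simplicial e A v)
    (0 < eval N h env (ESimplicial 5)).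
Proof.
move=> H e1 e5; rewrite eval_EAnd !eval_ENot (eval_EStatus H _ e5) // negbK.
set S := ESum 7 _.
have HS : reflect (exists x y : 'I_N, [&& x \in A, y \in A, e v x, e v y,
    x != y & ~~ e x y]) (0 < eval N h env S).
  rewrite /S eval_ESum; set inner := EAnd _ _.
  have P (x y : 'I_N) : (0 < eval N h (set_reg (set_reg env 7 x) 8 y) inner) =
      [&& x \in A, y \in A, e v x, e v y, x != y & ~~ e x y].
    pose env' := set_reg (set_reg env 7 x) 8 y.
    have [e7 e8 e5' e1'] : [/\ env' 7 = x, env' 8 = y, env' 5 = v & env' 1 = n] by [].
    have in_h := rep_input H.
    rewrite -/env' /inner 3!eval_EAnd (eval_EAdj in_h _ _ _ e5' e7) //.
    rewrite eval_EAnd (eval_EAdj in_h _ _ _ e5' e8) // eval_EAnd !eval_ENot.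
    rewrite (eval_EAdj in_h _ _ _ e7 e8) // (eval_EStatus H _ e7) //.
    rewrite (eval_EStatus H _ e8) // !negbK !lt0b.
    do 4 congr andb; congr andb; rewrite /= e7 e8 -val_eqE /=; lia.
  apply: (iffP (sum_gt0P _)) => [[x]|[x [y xy]]].
    by rewrite eval_ESum => /sum_gt0P[y]; rewrite P => xy; exists x, y.
  by exists x; rewrite eval_ESum; apply/sum_gt0P; exists y; rewrite P.
apply: (iffP andP) => -[vA HH]; split=> //.
  move=> x y xA yA vx vy xy; apply: contraR HH => nxy.
  by apply/HS; exists x, y; rewrite xA yA vx vy xy.
apply/HS => -[x [y /and5P[xA yA vx vy /andP[xy]]]].
by rewrite HH.
Qed.

Lemma eval_EBlocks (h env : nat -> nat) D A R (v : 'I_N) (xs : seq 'I_N) ys :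
  rep h D A R -> [disjoint R & A] -> env 1 = n -> env 5 = v ->
  0 \notin ys -> 6 \notin ys -> map env ys = map val xs ->
  eval N h env (EBlocks ys) = \sum_(w in [set w in R | e w v]) table h w xs.
Proof.
move=> H RA e1 e5 ys0 ys6 Eys; rewrite eval_ESum [RHS]big_mkcond.
apply: eq_bigr => w _; set env' := set_reg env 6 w.
have [e6 e5' e1'] : [/\ env' 6 = w, env' 5 = v & env' 1 = n] by [].
rewrite eval_EIf eval_EAnd (eval_ERoot H RA _ e6) //.
rewrite (eval_EAdj (rep_input H) _ _ _ e6 e5') // lt0b inE.
case: ifP => // _; rewrite eval_load_addr ?inE //.
by rewrite [map _ _]/= e6 map_set_reg // Eys.
Qed.

Lemma eval_EColour (h env : nat -> nat) D A R (v : 'I_N) (xs : seq 'I_N) ys j :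
  rep h D A R -> [disjoint R & A] -> env 1 = n -> env 5 = v -> size ys = t ->
  j < t -> 0 \notin ys -> 6 \notin ys -> 9 \notin ys -> map env ys = map val xs ->
  eval N h env (EColour ys j) =
    if (v \notin D) && ~~ e (nth pad xs j) v then
      (\sum_(w in [set w in R | e w v]) table h w (set_nth pad xs j v)).+1
    else 0.
Proof.
move=> H RA e1 e5 szy jt ys0 ys6 ys9 Eys.
have szx : size xs = t by rewrite -szy -(size_map env) Eys size_map.
have jy : j < size ys by rewrite szy.
have nin i : i \notin ys -> i != 5 -> i \notin set_nth 0 ys j 5.
  move=> iys i5; apply: contra iys => /(nthP 0)[k].
  rewrite size_set_nth (maxn_idPr jy) nth_set_nth /= => ky.
  by case: eqP => [_ E|_ <-]; [rewrite -E eqxx in i5 | rewrite mem_nth].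
have Ej : env (nth 0 ys j) = nth pad xs j.
  by rewrite -(nth_map 0 (env 0)) // Eys (nth_map pad) ?szx.
have ys9j : nth 0 ys j != 9 by apply: contraNneq ys9 => <-; rewrite mem_nth.
have Eset : map env (set_nth 0 ys j 5) = map val (set_nth pad xs j v).
  apply: (@eq_from_nth _ 0); rewrite !size_map !size_set_nth ?szy ?szx //.
  rewrite (maxn_idPr jt) => i it.
  rewrite (nth_map 0) ?(nth_map pad) ?size_set_nth ?szy ?szx ?(maxn_idPr jt) //.
  rewrite !nth_set_nth /=; case: eqP => // _.
  by rewrite -(nth_map 0 (env 0)) ?szy // Eys (nth_map pad) ?szx.
rewrite eval_EIf eval_load_addr // [map _ _]/= e5 (rep_deleted H) lt0b.
case: (v \in D); first by [].
rewrite [RHS]/= eval_EIf (eval_EAdj (rep_input H) _ _ _ Ej e5) // lt0b.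
case: (e _ _); first by [].
rewrite [RHS]/= eval_EAdd -add1n; congr (_ + _).
by apply: eval_EBlocks H RA _ _ _ _ Eset => //; apply: nin.
Qed.

Lemma eval_EBody (h env : nat -> nat) D A R (v : 'I_N) (xs : seq 'I_N) ys :
  rep h D A R -> [disjoint R & A] -> env 1 = n -> env 5 = v -> size ys = t ->
  0 \notin ys -> 6 \notin ys -> 9 \notin ys -> map env ys = map val xs ->
  eval N h env (EBody ys t) =
    dp_val e t pad D v
      (fun xs => \sum_(w in [set w in R | e w v]) table h w xs) xs.
Proof.
move=> H RA e1 e5 szy ys0 ys6 ys9 Eys.
pose S xs := \sum_(w in [set w in R | e w v]) table h w xs.
suff gen k : k <= t -> eval N h env (EBody ys k) =
    maxn (S xs) (\max_(j < k) if (v \notin D) && ~~ e (nth pad xs j) v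
                              then (S (set_nth pad xs j v)).+1 else 0).
  exact: gen.
elim: k => [|k IH] kt.
  by rewrite big_ord0 maxn0; apply: (eval_EBlocks H RA).
rewrite big_ord_recr maxnA -(IH (ltnW kt)) maxnE; congr (_ + (_ - _)).
exact: (eval_EColour H RA).
Qed.

(** The values written may depend only on what lies outside row [v] of the table, so the order of
    writing is immaterial and rewriting an entry repeats its value. [pre] holds the values of the
    enclosing loop variables and [Done] describes the entries already correct. *)
Lemma run_CFors v (F : seq nat -> nat) h0 ad bd :
  v < N ->
  forall vs pre env (Done : seq nat -> Prop) h o,
  size pre + size vs = t -> valid pre ->
  (forall zs h1, size zs = size vs -> valid zs ->
     frame (fun s => (size s == t.+2) && (take 2 s == [:: 2; v])) h0 h1 ->
     eval N h1 (binds env vs zs) ad = addr N [:: 2, v & pre ++ zs] /\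
     eval N h1 (binds env vs zs) bd = F (pre ++ zs)) ->
  frame (fun s => (size s == t.+2) && (take 2 s == [:: 2; v])) h0 h ->
  (forall zs, size zs = t -> valid zs -> Done zs ->
     h (addr N [:: 2, v & zs]) = F zs) ->
  let r := run N env (CFors vs (CPut ad bd)) (h, o) in
  [/\ r.2 = o,
    frame (fun s => (size s == t.+2) && (take 2 s == [:: 2; v])) h0 r.1 &
    forall zs, size zs = t -> valid zs ->
      Done zs \/ (exists ys, zs = pre ++ ys) -> r.1 (addr N [:: 2, v & zs]) = F zs].
Proof.
move=> vN; elim=> [|x vs IH] pre env Done h o sz vpre Hval fr HD.
  rewrite addn0 in sz.
  have [E1 E2] := Hval [::] h erefl isT fr; rewrite cats0 /= in E1 E2.
  rewrite /= E1 E2; split=> //.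
    apply: frame_trans fr _; apply: frame_put; rewrite //= ?sz ?take0 ?eqxx //.
    by rewrite vN vpre andbT; lia.
  have vcons s : valid s -> valid [:: 2, v & s].
    by move=> vs; rewrite /valid /= vN -/(valid s) vs andbT; lia.
  move=> zs szs vzs D; rewrite put_addr; [|exact: vcons..].
  case: eqP => [[->] //|ne]; case: D => [/HD -> //|[ys E]].
  case: ne; congr [:: _, _ & _]; have : size ys = 0 by move: szs; rewrite E size_cat; lia.
  by move/size0nil=> ys0; rewrite E ys0 cats0.
(* After [y] passes of the outermost loop, the tuples that continue [pre] with a digit below [y] are
   filled as well. *)
pose I y (st : (nat -> nat) * seq bool) := [/\ st.2 = o,
    frame (fun s => (size s == t.+2) && (take 2 s == [:: 2; v])) h0 st.1 &
    forall zs, size zs = t -> valid zs ->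
      Done zs \/ (exists z ys, z < y /\ zs = pre ++ z :: ys) ->
      st.1 (addr N [:: 2, v & zs]) = F zs].
have [] : I N (run N env (CFors (x :: vs) (CPut ad bd)) (h, o)); last first.
  move=> o' fr' H; split=> // zs szs vzs D; apply: H => //.
  case: D => [|[ys E]]; [by left | right].
  case: ys E => [|z ys] E; first by move: szs; rewrite E cats0 => s; move: sz => /=; lia.
  exists z, ys; split=> //; move: vzs; rewrite E /valid all_cat /=.
  by case/and3P.
rewrite /=; apply: iteri_ind.
  split=> // zs szs vzs [D|[z [ys []//]]]; exact: HD.
move=> y [h1 o1] yN [/= -> fr1 H1].
have [||zs h2 szs vzs fr2|||o2 fr2 H2] := IH (rcons pre y) (set_reg env x y)
   (fun zs => Done zs \/ (exists z ys, z < y /\ zs = pre ++ z :: ys)) h1 o.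
- by rewrite size_rcons -sz /= addSnnS.
- by rewrite /valid all_rcons /= yN.
- have [|||E1 E2] := Hval (y :: zs) h2; rewrite /= ?szs //.
    by rewrite /valid /= yN.
  by rewrite cat_rcons.
- exact: fr1.
- exact: H1.
split=> // zs szs vzs D; apply: H2 => //.
case: D => [|[z [ys [zy E]]]]; first by left; left.
move: zy; rewrite ltnS leq_eqVlt => /orP[/eqP zy|zy].
  by right; exists ys; rewrite cat_rcons -zy.
by left; right; exists z, ys.
Qed.

(** * Effect of the commands *)

Lemma run_CLet env i b c s :
  run N env (CLet i b c) s = run N (set_reg env i (eval N s.1 env b)) c s.
Proof. by []. Qed.

Lemma run_CSeq env c1 c2 s :
  run N env (CSeq c1 c2) s = run N env c2 (run N env c1 s).
Proof. by []. Qed.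

Lemma run_CFor env i c s :
  run N env (CFor i c) s = iteri N (fun y => run N (set_reg env i y) c) s.
Proof. by []. Qed.

Lemma run_CIf env b c1 c2 s : run N env (CIf b c1 c2) s =
  if 0 < eval N s.1 env b then run N env c1 s else run N env c2 s.
Proof. by []. Qed.

Lemma run_CPrint env b s :
  run N env (CPrint b) s = (s.1, rcons s.2 (0 < eval N s.1 env b)).
Proof. by []. Qed.

Lemma run_CPut env k vs b s : 0 \notin vs ->
  run N env (CPut (eaddr k vs) b) s =
  (set_reg s.1 (addr N (k :: map env vs)) (eval N s.1 env b), s.2).
Proof. by move=> v0; rewrite /run eval_eaddr. Qed.

Lemma valid2 k (w : 'I_N) : k < N -> valid [:: k; val w].
Proof. by move=> kN; rewrite /valid /= kN ltn_ord. Qed.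

Lemma valid_key (w : 'I_N) (xs : seq 'I_N) : valid [:: 2, val w & map val xs].
Proof.
rewrite /valid /= ltn_ord (ltn_trans _ N_gt3) //=.
by apply/allP => _ /mapP[x _ ->] /=; apply: ltn_ord.
Qed.

Lemma rep_frame (p : pred (seq nat)) h h' D A R : rep h D A R -> frame p h h' ->
  (forall k (w : 'I_N), k < 2 -> ~~ p [:: k; val w]) -> rep h' D A R.
Proof.
move=> [i d st] [fi f] np; split=> [|w|w]; first exact: fi.
- by rewrite f ?d ?np // valid2.
- by rewrite f ?st ?np // valid2.
Qed.

Lemma rep_put_status h (D A R A' R' : {set 'I_N}) (v : 'I_N) x : rep h D A R ->
  x = (if v \in A' then 0 else if v \in R' then 2 else 1) ->
  (forall w, w != v -> (w \in A') = (w \in A)) ->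
  (forall w, w != v -> (w \in R') = (w \in R)) ->
  rep (set_reg h (addr N [:: 1; val v]) x) D A' R'.
Proof.
move=> [i d st] xE AE RE; split=> [|w|w]; first exact: holds_input_put.
- by rewrite put_addr ?valid2 //= d.
- rewrite put_addr ?valid2 // st; case: eqP => [[/val_inj ->] //|ne].
  by have wv : w != v by [apply: contra_not_neq ne => ->]; rewrite AE ?RE.
Qed.

Lemma eq_dp_val (D : {set 'I_N}) v S S' xs : (forall xs, S xs = S' xs) ->
  dp_val e t pad D v S xs = dp_val e t pad D v S' xs.
Proof.
move=> E; rewrite /dp_val E; congr maxn; apply: eq_bigr => j _.
by rewrite E.
Qed.

(** Computing an optimum may overwrite tables 1 and 2 only; the deletion set and the reference
    optimum survive. *)
Definition work_key (s : seq nat) := (head 0 s == 1) || (head 0 s == 2).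

Lemma eval_pivot (h env : nat -> nat) (D A R : {set 'I_N}) z : rep h D A R -> env 1 = n ->
  z \in A -> exists v : 'I_N, [/\ v \in A, simplicial e A v &
    eval N h env (ESub (EMax 5 (EIf (ESimplicial 5) (EAdd (EVar 5) (EConst 1))
                          (EConst 0))) (EConst 1)) = v].
Proof.
move=> H e1 zA; have [v vA sv] := e_elim zA.
pose F (y : 'I_N) :=
  if 0 < eval N h (set_reg env 5 y) (ESimplicial 5) then y + 1 else 0.
have FP (y : 'I_N) : reflect (y \in A /\ simplicial e A y)
    (0 < eval N h (set_reg env 5 y) (ESimplicial 5)) by apply: (eval_ESimplicial H).
have [y Ey] : {y | \max_y F y = F y} by apply: eq_bigmax; rewrite card_ord.
have : 0 < F y.
  rewrite -Ey; apply: leq_trans (leq_bigmax v); rewrite /F.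
  by have /FP -> : v \in A /\ simplicial e A v by []; rewrite addn1.
rewrite /F; case: (FP y) => // -[yA sy] _; exists y; split=> //.
change (\max_y F y - 1 = y); rewrite Ey /F.
by have /FP -> : y \in A /\ simplicial e A y by []; rewrite addn1 subn1.
Qed.

Lemma run_CRound env h o (D A R : {set 'I_N}) sub z :
  rep h D A R -> elim_state e t pad D A R sub (table h) -> z \in A ->
  env 1 = n ->
  let r := run N env (CRound t) (h, o) in
  [/\ r.2 = o, frame work_key h r.1 & exists v R' sub', [/\ v \in A,
     rep r.1 D (A :\ v) R' & elim_state e t pad D (A :\ v) R' sub' (table r.1)]].
Proof.
move=> H HE zA e1; have [v [vA sv Ev]] := eval_pivot H e1 zA.
have RA : [disjoint R & A].
  by apply/pred0P => w /=; apply/negP => /andP[/(elim_root HE)/negP].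
have vR : v \notin R by apply/negP => /(elim_root HE); rewrite vA.
rewrite /CRound run_CLet [(h, o).1]/= Ev !run_CSeq.
move: (set_reg_eq env 5 v); have : set_reg env 5 v 1 = n by [].
move: (set_reg env 5 v) => {e1 Ev}env e1 e5.
pose S h xs := \sum_(w in [set w in R | e w v]) table h w xs.
pose p s := (size s == t.+2) && (take 2 s == [:: 2; val v]).
have np k (w : 'I_N) : k < 2 -> ~~ p [:: k; val w].
  by move=> k2; rewrite /p /= negb_and; apply/orP; right; apply/negP => /eqP[]; lia.
(* [v] is not yet a root, so filling its row does not disturb the block values that the row is
   computed from. *)
have S_frame h1 : frame p h h1 -> forall xs, S h1 xs = S h xs.
  move=> fr xs; apply: eq_bigr => w; rewrite inE => /andP[wR _].
  apply: fr.2 _ (valid_key _ _) _; rewrite /p /= take0 negb_and; apply/orP; right.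
  by apply: contraNneq vR => -[/val_inj <-].
have [|//|zs h1 szs vzs fr|||] := @run_CFors v
  (fun zs => dp_val e t pad D v (S h) (map (insubd pad) zs)) h
  (eaddr 2 (5 :: iota 10 t)) (EBody (iota 10 t) t) (ltn_ord v) (iota 10 t) [::]
  env (fun=> False) h o.
- by rewrite size_iota.
- have b5 : binds env (iota 10 t) zs 5 = v by rewrite binds_notin // mem_iota.
  have b1 : binds env (iota 10 t) zs 1 = n by rewrite binds_notin // mem_iota.
  have Ez : map (binds env (iota 10 t) zs) (iota 10 t) = zs.
    by rewrite map_binds ?iota_uniq.
  split; first by rewrite eval_eaddr ?inE ?mem_iota //= Ez b5.
  rewrite (@eval_EBody h1 _ D A R v (map (insubd pad) zs)) ?size_iota ?mem_iota //.
  + exact: eq_dp_val (S_frame h1 fr).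
  + exact: rep_frame H fr np.
  + rewrite Ez -map_comp -[LHS]map_id; apply/eq_in_map => x xz /=.
    by rewrite insubdK //; apply: (allP vzs).
- exact: frame_refl.
- by [].
case: (run N env _ (h, o)) => h1 o1; rewrite [(h1, o1).1]/= [(h1, o1).2]/=.
move=> -> fr1 H1.
have rep1 := rep_frame H fr1 np.
(* The roots left once the vertices below [y] have been scanned: those adjacent to [v] are absorbed
   into its block. *)
pose Ry y := [set w : 'I_N in R | ~~ ((w < y) && e w v)].
pose I y (st : (nat -> nat) * seq bool) := [/\ st.2 = o,
  frame (fun s => head 0 s == 1) h1 st.1 & rep st.1 D A (Ry y)].
have : I N (run N env (CFor 6 (CIf (EAnd (ERoot 6) (EAdj 6 5))
                   (CPut (eaddr 1 [:: 6]) (EConst 1)) CSkip)) (h1, o)).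
  rewrite run_CFor; apply: iteri_ind.
    split=> //; suff -> : Ry 0 = R by [].
    by apply/setP => w; rewrite inE andbT.
  move=> y [h2 o2] yN; rewrite {1}/I [(h2, o2).1]/= [(h2, o2).2]/=.
  move=> [-> fr2 rep2]; pose w := Ordinal yN.
  have RyA : [disjoint Ry y & A].
    by apply: disjointWl RA; apply/subsetP => u; rewrite inE => /andP[].
  rewrite run_CIf eval_EAnd (eval_ERoot (w := w) rep2) //.
  rewrite (eval_EAdj (x := w) (y := v) (rep_input rep2)) //.
  have -> : w \in Ry y = (w \in R) by rewrite inE ltnn andbT.
  rewrite lt0b; case: ifP => [/andP[wR wv]|nwv].
    rewrite run_CPut // [map _ _]/= set_reg_eq /=; split=> //=.
      apply: frame_trans fr2 _; apply: frame_put => //.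
      exact: (@valid2 1 w).
    apply: (rep_put_status (v := w) rep2) => //.
      by rewrite (disjointFr RA wR) inE /= ltnSn wv andbF.
    move=> u uw; rewrite !inE ltnS [u <= y]leq_eqVlt.
    by have -> : (val u == y) = false by apply: contraNF uw => /eqP E; apply/eqP/val_inj.
  split=> //=; suff -> : Ry y.+1 = Ry y by [].
  apply/setP => u; rewrite !inE ltnS [u <= y]leq_eqVlt.
  case: (eqVneq (val u) y) => // uy; have -> : u = w by apply: val_inj.
  by rewrite /= ltnn /=; case: (w \in R) nwv => //= ->.
case: (run N env _ (h1, o)) => h2 o2; rewrite /I [(h2, o2).1]/= [(h2, o2).2]/=.
move=> [-> fr2 rep2].
rewrite run_CPut // [map _ _]/= e5.
have fr3 : frame (fun s => head 0 s == 1) h1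
    (set_reg h2 (addr N [:: 1; val v]) 2).
  by apply: frame_trans fr2 _; apply: frame_put => //; apply: valid2.
have rep3 : rep (set_reg h2 (addr N [:: 1; val v]) 2) D (A :\ v)
    (v |: [set w in R | ~~ e w v]).
  apply: rep_put_status rep2 _ _ _; rewrite ?inE ?eqxx //.
    by move=> w wv; rewrite !inE wv.
  by move=> w wv; rewrite !inE (negPf wv) ltn_ord.
split=> //=.
  apply: frame_trans (frame_sub _ fr1) (frame_sub _ fr3).
    by move=> [|x [|y s]] //=; rewrite /p /work_key /= => /andP[_ /eqP[-> _]];
      rewrite orbT.
  by move=> s /= E; rewrite /work_key E.
have tab xs w : table (set_reg h2 (addr N [:: 1; val v]) 2) w xs = table h1 w xs.
  by apply: fr3.2 _ (valid_key _ _) _.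
have [|xs szx|sub' HE'] := elim_step e_sym e_irr pad_isolated HE vA sv
  (g' := table (set_reg h2 (addr N [:: 1; val v]) 2)).
- move=> w wR xs szx; rewrite tab; apply: fr1.2 _ (valid_key _ _) _.
  rewrite /p /= take0 negb_and; apply/orP; right.
  by apply: contraNneq vR => -[/val_inj <-].
- rewrite tab /table H1 ?size_map //.
  + rewrite -map_comp; congr dp_val.
    by rewrite -[RHS]map_id; apply: eq_map => x /=; apply: valKd.
  + by have := valid_key v xs; rewrite /valid /= => /and3P[].
  + by right; exists (map val xs).
by exists v, (v |: [set w in R | ~~ e w v]), sub'.
Qed.

Lemma eval_EOptimum (h env : nat -> nat) D R : rep h D set0 R -> env 2 = pad ->
  eval N h env (EOptimum t) = \sum_(w in R) table h w (nseq t pad).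
Proof.
move=> H e2; rewrite eval_ESum [RHS]big_mkcond; apply: eq_bigr => w _.
rewrite eval_EIf (eval_ERoot (w := w) H) //; last first.
  by apply/pred0P => u /=; rewrite !inE andbF.
case: ifP => // _; rewrite eval_load_addr; last first.
  by rewrite inE mem_nseq andbF.
by rewrite /table [map _ (6 :: _)]/= !map_nseq set_reg_eq set_reg_neq // e2.
Qed.

(** Table entries left over from an earlier call do no harm: with no roots, the elimination state
    claims nothing about the table, and a row is filled before its vertex becomes a root. *)
Lemma run_COptimum env h o (D : {set 'I_N}) :
  holds_input h -> (forall w : 'I_N, h (addr N [:: 0; val w]) = (w \in D)) ->
  env 1 = n -> env 2 = pad ->
  let r := run N env (COptimum t) (h, o) in
  [/\ r.2 = o, frame work_key h r.1 &
      max_coloured e t pad D setT (nseq t pad) (eval N r.1 env (EOptimum t))].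
Proof.
move=> Hi HD e1 e2; rewrite /COptimum run_CSeq.
pose I y (st : (nat -> nat) * seq bool) := [/\ st.2 = o, frame work_key h st.1 &
  forall w : 'I_N, w < y -> st.1 (addr N [:: 1; val w]) = 0].
have : I N (run N env (CFor 6 (CPut (eaddr 1 [:: 6]) (EConst 0))) (h, o)).
  rewrite run_CFor; apply: iteri_ind; first by [].
  move=> y [h1 o1] yN; rewrite {1}/I [(h1, o1).1]/= [(h1, o1).2]/=.
  move=> [-> fr1 H1]; pose y' := Ordinal yN.
  rewrite run_CPut // [map _ _]/= set_reg_eq; split=> //=.
    by apply: frame_trans fr1 _; apply: frame_put => //; apply: (@valid2 1 y').
  move=> w; rewrite ltnS (@put_addr _ [:: 1; y]) ?valid2 //; last exact: (@valid2 1 y').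
  case: eqP => // ne wy; rewrite H1 // ltn_neqAle wy andbT.
  by apply: contra_not_neq ne => ->.
case: (run N env _ (h, o)) => h1 o1; rewrite /I [(h1, o1).1]/= [(h1, o1).2]/=.
move=> [-> fr1 H1].
have rep1 : rep h1 D setT set0.
  split=> [|w|w]; first exact: fr1.1.
    by rewrite fr1.2 ?valid2.
  by rewrite H1 ?inE.
pose J s (st : (nat -> nat) * seq bool) := [/\ st.2 = o, frame work_key h st.1 &
  exists (A R : {set 'I_N}) sub, [/\ #|A| = N - s, rep st.1 D A R &
    elim_state e t pad D A R sub (table st.1)]].
have : J N (run N env (CFor 4 (CRound t)) (h1, o)).
  rewrite run_CFor; apply: iteri_ind.
    split=> //; exists setT, set0, (fun=> set0); split=> //.
      by rewrite cardsT card_ord subn0.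
    exact: elim_state0.
  move=> s [h2 o2] sN; rewrite {1}/J [(h2, o2).1]/= [(h2, o2).2]/=.
  move=> [-> fr2 [A [R [sub [szA rep2 HE]]]]].
  have [A0|[z zA]] := set_0Vmem A; first by move: szA; rewrite A0 cards0; lia.
  have [] := @run_CRound (set_reg env 4 s) h2 o D A R sub z rep2 HE zA e1.
  move=> oE fr3 [v [R' [sub' [vA rep3 HE3]]]]; split=> //.
    exact: frame_trans fr2 fr3.
  exists (A :\ v), R', sub'; split=> //.
  by move: szA; rewrite (cardsD1 v) vA; lia.
case: (run N env _ (h1, o)) => h2 o2; rewrite /J [(h2, o2).1]/= [(h2, o2).2]/=.
move=> [-> fr2 [A [R [sub [szA rep2 HE]]]]]; split=> //.
have A0 : A = set0 by apply/eqP; rewrite -cards_eq0 szA subnn.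
rewrite A0 in rep2 HE; rewrite (eval_EOptimum rep2 e2).
exact: elim_final HE.
Qed.

Lemma eval_order (h env : nat -> nat) :
  eval N h env (ESum 8 (ENot (ESub (EAdd (EMul 8 8) (EAdd (EVar 8)
                                (EAdd (EVar 8) (EConst 1))))
                          (ESub (ESum 0 (EConst 1)) (EConst 4))))) = n.
Proof.
rewrite eval_ESum -[RHS]muln1 -(sum_ltn_ord 1 (ltnW n_lt)); apply: eq_bigr => z _.
rewrite eval_EIf; set env' := set_reg env 8 z.
have E := @eval_EMul N h env' 8 8 isT isT (ltnW (ltn_ord z)).
move: (EMul 8 8) E => M E; rewrite /= E sum_const_ord /env' set_reg_eq.
have -> : 1 * N - 4 = n * n by lia.
rewrite subn_gt0.
have -> : z * z + (z + (z + 1)) = z.+1 * z.+1 by lia.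
by rewrite !mulnn ltn_sqr ltnS; case: leqP.
Qed.

(** The result is phrased as maximality of the complement of [D] among colourable sets of padded
    vertices, whereas only the first [n] bits of [d] are printed. *)
Lemma run_CMain env h : holds_input h ->
  (forall w : 'I_N, h (addr N [:: 0; val w]) = 0) ->
  exists d : nat -> bool, let D := [set w : 'I_N | d w] in
  [/\ (run N env (CMain t) (h, [::])).2 = map d (iota 0 n),
    exists c, {in ~: D, forall u, c u < t} /\
     {in ~: D &, forall u u', c u = c u' -> ~~ e u u'} &
    forall (S : {set 'I_N}) (c : 'I_N -> nat), {in S, forall u, c u < t} ->
     {in S &, forall u u', c u = c u' -> ~~ e u u'} -> #|S| <= #|~: D|].
Proof.
move=> Hi H0; rewrite /CMain !run_CLet eval_order.
have Ep : eval N (h, @nil bool).1 (set_reg env 1 n)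
    (ESub (ESum 0 (EConst 1)) (EConst 1)) = pad.
  by rewrite /= sum_const_ord mul1n subn1.
rewrite {}Ep; set env' := set_reg (set_reg env 1 n) 2 pad.
have [e1 e2] : env' 1 = n /\ env' 2 = pad by [].
move: env' e1 e2 => {}env e1 e2.
rewrite (run_CSeq _ (COptimum t)) (run_CSeq _ (CPut _ _)) (run_CSeq _ (CFor 3 _)).
have H0' (w : 'I_N) : h (addr N [:: 0; val w]) = (w \in set0) by rewrite H0 inE.
have [] := @run_COptimum env h [::] set0 Hi H0' e1 e2.
case: (run N env _ (h, [::])) => h1 o1; rewrite [(h1, o1).1]/= [(h1, o1).2]/=.
move=> -> fr1; set m := eval N h1 env _ => opt0.
rewrite run_CPut // [map _ _]/= -/m.
have key3 : valid [:: 3] by rewrite /valid /= N_gt3.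
pose opt (D : {set 'I_N}) := max_coloured e t pad D setT (nseq t pad).
pose good (D : {set 'I_N}) h := [/\ holds_input h,
  forall w : 'I_N, h (addr N [:: 0; val w]) = (w \in D),
  h (addr N [:: 3]) = m & opt D m].
(* Vertices below [y] that were kept stay indispensable: deleting one on top of [D] lowers the
   optimum, and this persists as [D] grows, since more deletions admit fewer colourings. *)
pose I y (st : (nat -> nat) * seq bool) := st.2 = [::] /\ exists D,
  [/\ good D st.1, {in D, forall u : 'I_N, u < y} &
    forall (u : 'I_N) c, u < y -> u \notin D ->
      colours e t pad (u |: D) setT (nseq t pad) c -> #|coloured t setT c| < m].
have : I N (run N env (CFor 3 (CSeq (CPut (eaddr 0 [:: 3]) (EConst 1))
                (CSeq (COptimum t)
                      (CIf (ESub (ELoad (eaddr 3 [::])) (EOptimum t))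
                         (CPut (eaddr 0 [:: 3]) (EConst 0)) CSkip))))
    (set_reg h1 (addr N [:: 3]) m, [::])).
  rewrite run_CFor; apply: iteri_ind.
    split=> //; exists set0; split=> //; last by move=> u; rewrite inE.
    split=> //=.
    - exact: holds_input_put (fr1.1 Hi).
    - by move=> w; rewrite put_addr ?valid2 //= fr1.2 ?valid2 // H0 inE.
    - by rewrite set_reg_eq.
  move=> y [h2 o2] yN; rewrite {1}/I [(h2, o2).1]/= [(h2, o2).2]/=.
  move=> [-> [D [[in2 D2 m2 opt2] Dy peel]]]; pose u := Ordinal yN.
  have uD : u \notin D by apply/negP => /Dy; rewrite ltnn.
  set env' := set_reg env 3 y.
  have [e1' e2' e3'] : [/\ env' 1 = n, env' 2 = pad & env' 3 = u] by [].
  rewrite (run_CSeq _ (CPut _ _)) (run_CSeq _ (COptimum t)).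
  rewrite run_CPut // [map _ _]/= e3' [(h2, _).1]/= [(h2, _).2]/=.
  have vy : valid [:: 0; y] by apply: (@valid2 0 u).
  set h3 := set_reg h2 _ _.
  have in3 : holds_input h3 by apply: holds_input_put.
  have D3 (w : 'I_N) : h3 (addr N [:: 0; val w]) = (w \in u |: D).
    rewrite /h3 put_addr ?valid2 // D2 !inE -val_eqE eqseq_cons eqxx /= eqseq_cons andbT.
    by case: eqP.
  have [] := @run_COptimum env' h3 [::] (u |: D) in3 D3 e1' e2'.
  case: (run N env' _ (h3, [::])) => h4 o4; rewrite [(h4, o4).1]/= [(h4, o4).2]/=.
  move=> -> fr4 opt4; rewrite run_CIf.
  have m4 : h4 (addr N [:: 3]) = m by rewrite fr4.2 // /h3 put_addr ?valid2.
  have in4 := fr4.1 in3.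
  have -> : eval N (h4, @nil bool).1 env' (ESub (ELoad (eaddr 3 [::])) (EOptimum t))
      = m - eval N h4 env' (EOptimum t).
    by rewrite -m4 -(@eval_load_addr h4 env' 3 [::]).
  move: opt4; set m' := eval N h4 env' _ => opt4.
  rewrite subn_gt0; case: ltnP => lt.
    rewrite run_CPut // [map _ _]/= e3'; split=> //; exists D; split=> /=.
    - split=> // [|w|].
      + exact: holds_input_put.
      + rewrite put_addr ?vy ?valid2 // fr4.2 ?valid2 // D3 !inE -val_eqE.
        rewrite eqseq_cons eqxx /= eqseq_cons andbT; case: eqP => //= wu.
        by have -> : w = u by [apply: val_inj]; rewrite (negPf uD).
      + by rewrite put_addr ?vy.
    - by move=> w /Dy; apply: ltnW.
    - move=> w c; rewrite ltnS leq_eqVlt => /orP[/eqP wy|wy] wD.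
        have -> : w = u by apply: val_inj.
        by move=> /opt4.2 le; apply: leq_ltn_trans le lt.
      exact: peel.
  (* A further deletion cannot raise the optimum, so if it does not drop it is unchanged. *)
  have mm : m' = m.
    apply/eqP; rewrite eqn_leq lt andbT; have [[c cok <-] _] := opt4.
    by apply: opt2.2; apply: colours_anti cok; apply: subsetUr.
  split=> //; exists (u |: D); split=> /=.
  - split=> // [w|]; last by rewrite -mm.
    by rewrite fr4.2 ?valid2.
  - by move=> w; rewrite !inE => /orP[/eqP->|/Dy]; rewrite ltnS // => /ltnW.
  - move=> w c; rewrite ltnS leq_eqVlt => /orP[/eqP wy|wy].
      have -> : w = u by apply: val_inj.
      by rewrite !inE eqxx.
    rewrite !inE negb_or => /andP[_ wD] cok; apply: (peel w) => //.
    by apply: colours_anti cok; apply: setUS; apply: subsetUr.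
case: (run N env _ (_, [::])) => h2 o2; rewrite /I [(h2, o2).1]/= [(h2, o2).2]/=.
move=> [-> [D [[in2 D2 m2 opt2] Dy peel]]].
exists (fun x => insubd pad x \in D).
have -> : [set w : 'I_N | insubd pad w \in D] = D.
  by apply/setP => w; rewrite inE valKd.
have [col best] := peel_optimal pad_isolated opt0 opt2 (fun u c => peel u c (ltn_ord u)).
split=> //.
pose J y (st : (nat -> nat) * seq bool) := st.1 = h2 /\
  st.2 = [seq insubd pad x \in D | x <- iota 0 (minn y n)].
have : J N (run N env (CFor 3 (CIf (ESub (EVar 1) (EVar 3)) (CPrint (EDeleted 3)) CSkip))
     (h2, [::])).
  rewrite run_CFor; apply: iteri_ind; first by rewrite /J min0n.
  move=> y [h3 o3] yN; rewrite {1}/J [(h3, o3).1]/= [(h3, o3).2]/=.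
  move=> [-> ->]; rewrite run_CIf.
  have -> : eval N (h2, @nil bool).1 (set_reg env 3 y) (ESub (EVar 1) (EVar 3)) = n - y.
    by rewrite /= set_reg_eq set_reg_neq // e1.
  rewrite subn_gt0; case: ltnP => yn; last first.
    by split=> //; rewrite (minn_idPr (leqW yn)).
  rewrite run_CPrint eval_load_addr // [map _ [:: 3]]/= set_reg_eq [(h2, _).1]/=.
  have := D2 (Ordinal yN); rewrite [val _]/= => ->; split=> //=.
  rewrite lt0b (minn_idPl yn) -addn1 iotaD map_cat /= cats1.
  by congr rcons; congr (_ \in D); apply: val_inj; rewrite val_insubd yN.
case: (run N env _ (h2, [::])) => h3 o3 [_ /= ->].
by rewrite (minn_idPr (ltnW n_lt)).
Qed.

End Correctness.

(** * Padding the graph with isolated vertices *)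

Lemma nth_allpairs (S T R : Type) (f : S -> T -> R) s r x0 y0 z0 i j :
  i < size s -> j < size r ->
  nth z0 [seq f x y | x <- s, y <- r] (i * size r + j) =
  f (nth x0 s i) (nth y0 r j).
Proof.
move=> + jr; elim: s i => [|x s IH] [|i] //= il; rewrite nth_cat size_map.
  by rewrite mul0n add0n jr (nth_map y0).
by rewrite mulSn -addnA ltnNge leq_addr /= addKn IH.
Qed.

Lemma leq_card_in (T : finType) (K : {set T}) (c : T -> nat) t :
  {in K, forall u, c u < t} -> {in K &, injective c} -> #|K| <= t.
Proof.
move=> lt inj; rewrite cardE -(size_map c) -[leqRHS](size_iota 0).
apply: uniq_leq_size.
  by rewrite map_inj_in_uniq ?enum_uniq // => u u'; rewrite !mem_enum; apply: inj.
by move=> _ /mapP[u + ->]; rewrite mem_enum mem_iota => /lt.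
Qed.

(** The vertices of a clique get pairwise different colours, and only [p.-1] are available. *)
Lemma clique_deletion_of_colouring (G : sgraph) p (V : {set G}) (c : G -> nat) :
  0 < p -> {in ~: V, forall u, c u < p.-1} ->
  {in ~: V &, forall u u', c u = c u' -> ~~ adj u u'} ->
  clique_deletion_set p V.
Proof.
move=> p0 lt ok [K [Kcl Kp]].
have notV (x : {x : G | x \notin V}) : val x \in ~: V by rewrite inE (valP x).
suff : #|K| <= p.-1 by rewrite Kp; lia.
apply: (@leq_card_in _ _ (fun x => c (val x))) => [x xK|x y xK yK cxy].
  exact: lt.
by apply: contraTeq (ok _ _ (notV x) (notV y) cxy) => xy; rewrite negbK; apply: Kcl.
Qed.

Section Padding.

Variables (G : sgraph) (N : nat).
Hypothesis ltN : #|G| < N.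

Let n := #|G|.
Let w := encode_graph G.
Let a x y := nth false w (x * n + y).
Let e : rel 'I_N := fun x y => [&& x < n, y < n & a x y].
Let emb (g : G) : 'I_N := widen_ord (ltnW ltN) (enum_rank g).

Lemma size_encode_graph : size w = n * n.
Proof. by rewrite size_allpairs -cardE. Qed.

Lemma emb_inj : injective emb.
Proof. by move=> g g' [] /val_inj/enum_rank_inj. Qed.

Lemma embP (x : 'I_N) : x < n -> exists g, x = emb g.
Proof.
move=> xn; exists (enum_val (Ordinal xn)); apply: val_inj.
by rewrite /= enum_valK.
Qed.

Lemma e_emb g g' : e (emb g) (emb g') = adj g g'.
Proof.
have lt g1 : emb g1 < n by apply: (ltn_ord (enum_rank g1)).
rewrite /e !lt /a /n {1}cardE (@nth_allpairs _ _ _ _ _ _ g g) -?cardE //.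
by rewrite !nth_enum_rank.
Qed.

Lemma e_sym : symmetric e.
Proof.
move=> x y; case: (ltnP x n) => [/embP[g ->]|xn].
  case: (ltnP y n) => [/embP[g' ->]|yn]; first by rewrite !e_emb adj_sym.
  by rewrite /e [y < n]ltnNge yn !andbF.
by rewrite /e [x < n]ltnNge xn !andbF.
Qed.

Lemma e_irr : irreflexive e.
Proof.
move=> x; case: (ltnP x n) => [/embP[g ->]|xn]; first by rewrite e_emb adj_irr.
by rewrite /e ltnNge xn.
Qed.

Lemma e_range x y : e x y -> exists g g', x = emb g /\ y = emb g'.
Proof. by case/and3P=> /embP[g ->] /embP[g' ->] _; exists g, g'. Qed.

(** A padding vertex in [A] is isolated and hence trivially simplicial; without one, [A] is a copy
    of a set of vertices of [G]. *)
Lemma e_elim : chordal G -> simplicial_elimination e.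
Proof.
move=> chG A z zA; case: (pickP [pred x in A | n <= val x]) => [x /andP[xA nx]|small].
  by exists x => // b c _ _; rewrite /e ltnNge nx.
have inA x : x \in A -> exists2 g, x = emb g & emb g \in A.
  move=> xA; have := small x; rewrite inE xA /= leqNgt => /negbFE /embP[g xg].
  by exists g => //; rewrite -xg.
have [gz _ gzA] := inA z zA.
have [|g] := chordal_elimination chG (A := [set g | emb g \in A]) (z := gz).
  by rewrite inE.
rewrite inE => gA sg; exists (emb g) => // x y /inA[g1 -> g1A] /inA[g2 -> g2A].
rewrite !e_emb => gg1 gg2 ne; apply: sg; rewrite ?inE //.
by apply: contraNneq ne => ->.
Qed.

(** Greedy colouring applies because a clique on [p] vertices outside the image of [W] would come
    from one in [G] without [W]. *)
Lemma colouring_of_clique_deletion p (W : {set G}) : 1 < p -> chordal G ->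
  clique_deletion_set p W ->
  exists c, {in ~: (emb @: W), forall u, c u < p.-1} /\
    {in ~: (emb @: W) &, forall u u', c u = c u' -> ~~ e u u'}.
Proof.
move=> p1 chG Wdel; apply: greedy_colouring e_sym e_irr (e_elim chG) _ => K KW Kcl.
rewrite -ltnS prednK ?(ltnW p1) // ltnNge; apply/negP => /card_geqP[s [Us szs sK]].
pose K0 := [set x in s].
have K0K x : x \in K0 -> x \in K by rewrite inE => /sK.
have K0p : #|K0| = p by rewrite cardsE -szs; apply/card_uniqP.
(* Since [1 < p], each vertex of [K0] has a neighbour in [K0], so it is not a padding vertex. *)
have K0emb x : x \in K0 -> exists2 g, x = emb g & g \notin W.
  move=> xK0; have : 0 < #|K0 :\ x| by move: K0p; rewrite (cardsD1 x) xK0; lia.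
  case/card_gt0P=> y; rewrite 2!inE => /andP[yx yK0].
  have /e_range[g [_ [xg _]]] : e x y by apply: Kcl; rewrite ?K0K // eq_sym.
  exists g => //; have /(subsetP KW) := K0K x xK0.
  by rewrite inE xg mem_imset //; apply: emb_inj.
apply: Wdel; exists [set z | emb (val z) \in K0]; split.
  move=> z z'; rewrite !inE => zK z'K zz'; rewrite /= /del_adj -e_emb.
  apply: Kcl; try exact: sK.
  by rewrite (inj_eq emb_inj) val_eqE.
rewrite -K0p -(@card_imset _ _ (fun z : del_vertices W => emb (val z))); last first.
  by move=> z z' /emb_inj/val_inj.
apply: eq_card => x; apply/imsetP/idP => [[z + ->]|xK0]; first by rewrite inE.
have [g xg gW] := K0emb x xK0.
by exists (exist _ g gW); rewrite // in_set /= -xg.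
Qed.

End Padding.

Theorem theorem7 (p : nat) (hp : 1 < p) :
  poly_time_solvable encode_graph encode_vset chordal
    (min_clique_deletion_set p).
Proof.
have [P [b [k HP]]] := compile_correct (CMain p.-1).
exists P, b, k => G chG; have [s sB Hs] := HP (encode_graph G).
set w := encode_graph G in sB Hs; set N := size w + 4 in Hs; pose n := #|G|.
have szw : size w = n * n by apply: size_encode_graph.
have nN : n * n + 4 = N by rewrite -szw.
have ltN : n < N by rewrite -nN; nia.
have N0 : 0 < N by lia.
pose a x y := nth false w (x * n + y).
have [||d [out [c [c_lt c_ok]] best]] := @run_CMain N n p.-1 a nN
  (@e_sym G N ltN) (@e_irr G N ltN) (e_elim ltN chG) (fun=> N) (heap_of w).
- move=> x y xn yn; rewrite /heap_of (nth_map false) // szw; nia.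
- move=> u; rewrite /heap_of nth_default // size_map.
  by apply: leq_trans (addr_ge N0 _) => //; rewrite /N leq_addr.
pose emb (g : G) : 'I_N := widen_ord (ltnW ltN) (enum_rank g).
have embI : injective emb by apply: emb_inj.
pose V := [set g | d (emb g)].
exists s, V; split=> //.
  suff -> : encode_vset V = map d (iota 0 n) by rewrite -out.
  have -> : encode_vset V = map d [seq val (enum_rank g) | g <- enum G].
    by rewrite -map_comp; apply: eq_map => g; rewrite inE.
  congr map; apply: (@eq_from_nth _ 0); rewrite size_map -cardE ?size_iota // => i il.
  pose j : 'I_#|G| := Ordinal il.
  rewrite (nth_map (enum_val j)) -?cardE // nth_iota // add0n.
  by rewrite -(enum_val_nth (enum_val j) j) enum_valK.
have VD : emb @: V \subset [set u : 'I_N | d u].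
  by apply/subsetP => _ /imsetP[g + ->]; rewrite !inE.
split.
  apply: (@clique_deletion_of_colouring G p V (c \o emb)); first exact: ltnW.
    by move=> g; rewrite !inE => gV; apply: c_lt; rewrite !inE.
  move=> g g'; rewrite !inE => gV g'V cc; rewrite -(e_emb ltN).
  by apply: c_ok cc; rewrite !inE.
move=> W Wdel.
have [c' [c'_lt c'_ok]] := colouring_of_clique_deletion ltN hp chG Wdel.
rewrite -(card_imset V embI) -(card_imset W embI).
(* The image of [V] lies in the computed set. Complements are compared in the padded graph: the
   complement of the image of [W] is colourable, and that of the computed set is a largest
   colourable set. *)
apply: leq_trans (subset_leq_card VD) _.
rewrite -(leq_add2r #|~: [set u : 'I_N | d u]|) cardsC -(cardsC (emb @: W)).
by rewrite leq_add2l; apply: best c'_lt c'_ok.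
Qed.
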